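(* Let $\Omega\subset\mathbb{R}^2$ be a bounded Lipschitz domain, and for each $\mu>0$ let $v_\mu$ be the solution of the boundary value problem $$\Delta v_\mu-\mu^2 v_\mu=0\ \text{ in } \Omega,\qquad v_\mu|_{\partial\Omega}=1.$$ Then the following are equivalent: (i) there exists $\mu_0>0$ such that for all $\mu\geqslant\mu_0$ the inequality $$|\nabla v_\mu(x)|\leqslant \mu\, v_\mu(x)\quad\text{for all } x\in\Omega$$ holds; (ii) $\Omega$ is convex. Moreover, in this case (i.e. if $\Omega$ is convex), the inequality $|\nabla v_\mu(x)|\leqslant\mu\, v_\mu(x)$ for all $x\in\Omega$ holds for every $\mu>0$.
   Context: A domain is a nonempty connected open set. A bounded Lipschitz domain is a bounded domain whose boundary is locally, in suitable Cartesian coordinates, the graph of a Lipschitz function with the domain lying locally on one side of the graph. The solution $v_\mu$ is understood in the classical sense: $v_\mu\in C^2(\Omega)\cap C(\overline{\Omega})$ satisfies the equation pointwise in $\Omega$ and equals $1$ on $\partial\Omega$. For a bounded Lipschitz domain and every $\mu>0$ such a solution exists; it is unique and satisfies $0<v_\mu<1$ in $\Omega$ by the maximum principle. Here $\nabla$ is the gradient, $|\cdot|$ the Euclidean norm, and $\Delta$ the Laplacian in $\mathbb{R}^2$. *)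

(* Defs.v *)
From mathcomp Require Import all_boot all_order all_algebra.
From mathcomp Require Import all_classical all_reals all_analysis.

Set Implicit Arguments.
Unset Strict Implicit.
Unset Printing Implicit Defensive.

Import Order.TTheory GRing.Theory Num.Theory.
Import numFieldNormedType.Exports.

Local Open Scope classical_set_scope.
Local Open Scope ring_scope.

Definition boundary (T : topologicalType) (A : set T) : set T :=
  closure A `\` A°.

(* The library norm on row vectors is the sup norm, hence this Euclidean one. *)
Definition enorm (R : realType) (x : 'rV[R]_2) : R :=
  Num.sqrt (\sum_(i < 2) x 0 i ^+ 2).

Definition basis_vec (R : realType) (i : 'I_2) : 'rV[R]_2 := delta_mx 0 i.

Definition partial (R : realType) (i : 'I_2) (f : 'rV[R]_2 -> R) :
  'rV[R]_2 -> R := 'D_(basis_vec R i) f.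

Definition gradient (R : realType) (f : 'rV[R]_2 -> R) (x : 'rV[R]_2) :
  'rV[R]_2 := \row_(i < 2) partial i f x.

Definition laplacian (R : realType) (f : 'rV[R]_2 -> R) (x : 'rV[R]_2) : R :=
  \sum_(i < 2) partial i (partial i f) x.

(* [f] is a total function, but for [A] open this only involves the values
   of [f] on [A]. *)
Definition C1_on (R : realType) (A : set 'rV[R]_2) (f : 'rV[R]_2 -> R) : Prop :=
  (forall x, A x -> {for x, continuous f}) /\
  (forall i x, A x ->
     derivable f x (basis_vec R i) /\ {for x, continuous (partial i f)}).

Definition C2_on (R : realType) (A : set 'rV[R]_2) (f : 'rV[R]_2 -> R) : Prop :=
  C1_on A f /\ (forall i, C1_on A (partial i f)).

Definition domain (R : realType) (A : set 'rV[R]_2) : Prop :=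
  [/\ A !=set0, open A & connected A].

(* Near [p], in the Cartesian coordinates [y = (x - p) *m Q] with [Q]
   orthogonal, the boundary of [A] is the graph of the Lipschitz function [g]
   and [A] is the part strictly above it. *)
Definition lipschitz_boundary_at (R : realType) (A : set 'rV[R]_2)
    (p : 'rV[R]_2) : Prop :=
  exists (Q : 'M[R]_2) (g : R -> R) (U : set 'rV[R]_2),
    [/\ Q *m Q^T = 1%:M,
        lipschitz g,
        nbhs p U,
        (forall x, U x ->
           (boundary A x <-> ((x - p) *m Q) 0 1 = g (((x - p) *m Q) 0 0))) &
        (forall x, U x ->
           (A x <-> g (((x - p) *m Q) 0 0) < ((x - p) *m Q) 0 1))].

Definition bounded_lipschitz_domain (R : realType) (A : set 'rV[R]_2) : Prop :=
  [/\ domain A, bounded_set A & forall p : 'rV[R]_2, boundary A p ->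
    lipschitz_boundary_at A p].

Definition classical_solution (R : realType) (Omega : set 'rV[R]_2) (mu : R)
    (v : 'rV[R]_2 -> R) : Prop :=
  [/\ C2_on Omega v,
      {within closure Omega, continuous v},
      (forall x, Omega x -> laplacian v x - mu ^+ 2 * v x = 0) &
      (forall x : 'rV[R]_2, boundary Omega x -> v x = 1)].

(* Main.v *)
(* A supersolution may be compared with [v] through the maximum principle for
   [Delta - mu ^+ 2].

   If [Omega] is convex, a half-plane supporting [Omega] near a boundary point
   [x] gives an exponential subsolution, whence [exp (- mu |y - x|) <= v y].
   The function [exp (mu |h|) v (x + h) - v x] is then nonnegative on the boundary
   of the intersection of [Omega] and [Omega - h], hence inside it, and the limit
   [h -> 0] along the direction opposite to the gradient bounds the gradient.

   Conversely [u = - ln v / mu] satisfies [|grad u| <= 1], so it is superharmonic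
   and bounded by the distance [d] to the complement of [Omega], while a radial
   barrier gives [u >= d - o(1)] as [mu] grows. If [Omega] is not convex, some disc
   centred at [z] and passing through a point [p] of the complement contains the
   complement near [p]. Thus [d] is locally at least [|x - z| - |p - z|], with
   equality on the normal through [p]. As [|x - z|] is strictly subharmonic in the
   plane, this contradicts the superharmonicity of [u] for large [mu]. *)
Require Import Defs.
From mathcomp Require Import all_boot all_order all_algebra.
From mathcomp Require Import all_classical all_reals all_analysis.
From mathcomp Require Import ring lra.

Import Order.TTheory GRing.Theory Num.Theory.
Import numFieldNormedType.Exports.

Local Open Scope classical_set_scope.
Local Open Scope ring_scope.

Set Implicit Arguments.
Unset Strict Implicit.
Unset Printing Implicit Defensive.

(** * Second-order jets of real functions *)

Section jets.
Context {R : realType}.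
Implicit Types (f g : R -> R) (a b c d x t : R).

(** The difference quotient is eventually within [b] of its limit [b], hence positive. It serves the
    second-derivative test, where [f] is itself a derivative, and the gradient bound on convex
    domains. *)
Lemma gt0_is_derive_right f x b : is_derive x 1 f b -> 0 < b ->
  exists2 e, 0 < e & forall t, 0 < t < e -> f x < f (x + t).
Proof.
move=> [df <-] b0.
have /cvgrPdist_lt /(_ _ b0) :
    (fun h => h^-1 *: (f (h *: (1 : R) + x) - f x)) @ 0^' --> 'D_1 f x by exact: df.
rewrite /dnbhs /within /= => /nbhs_ballP[e /= e0 H].
exists e => // t /andP[t0 te].
have := H t; rewrite /ball /= sub0r normrN gtr0_norm// => /(_ te).
rewrite gt_eqF// => /(_ isT); rewrite [t *: 1]mulr1 [t + x]addrC => h.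
have : 0 < t^-1 *: (f (x + t) - f x).
  by move: h; rewrite ltr_norml => /andP[_]; rewrite ltrBlDr ltrDl.
by rewrite [_ *: _]mulrC pmulr_lgt0 ?invr_gt0// subr_gt0.
Qed.

Definition jet2 f a b := exists f',
  [/\ \forall t \near (0 : R), is_derive (t : R) 1 f (f' t), f' 0 = a
    & is_derive (0 : R) 1 f' b].

Lemma is_derive_affine c d t : is_derive (t : R) 1 (fun s => c + s * d) d.
Proof.
have h : is_derive (t : R) 1 (cst c + d *: id) (0 + d *: 1).
  by apply: is_deriveD; apply: is_deriveZ.
rewrite (_ : (fun s => _) = cst c + d *: id).
  by apply: (is_derive_eq h); rewrite add0r [_ *: _]mulr1.
by apply/funext => y; rewrite mulrC.
Qed.

Lemma jet2_affine c d : jet2 (fun t => c + t * d) d 0.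
Proof.
exists (cst d); split => //; last exact: is_derive_cst.
by near=> t; exact: is_derive_affine.
Unshelve. all: by end_near. Qed.

Lemma jet2_cst c : jet2 (cst c) 0 0.
Proof.
exists (cst 0); split => //; last exact: is_derive_cst.
by near=> t; exact: is_derive_cst.
Unshelve. all: by end_near. Qed.

Lemma jet2D f g a b c d : jet2 f a b -> jet2 g c d ->
  jet2 (fun t => f t + g t) (a + c) (b + d).
Proof.
move=> [f' [ff' f'0 f'b]] [g' [gg' g'0 g'd]].
exists (fun t => f' t + g' t); split; [|by rewrite f'0 g'0|exact: is_deriveD].
near=> t; apply: is_deriveD; near: t; [exact: ff'|exact: gg'].
Unshelve. all: by end_near. Qed.

Lemma jet2M f g a b c d : jet2 f a b -> jet2 g c d ->
  jet2 (fun t => f t * g t) (a * g 0 + f 0 * c)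
    (b * g 0 + 2 * (a * c) + f 0 * d).
Proof.
move=> [f' [ff' f'0 f'b]] [g' [gg' g'0 g'd]].
have f0 := nbhs_singleton ff'; have g0 := nbhs_singleton gg'.
exists (fun t => f' t * g t + f t * g' t); split; [|by rewrite f'0 g'0|].
  near=> t.
  have ft : is_derive (t : R) 1 f (f' t) by near: t.
  have gt : is_derive (t : R) 1 g (g' t) by near: t.
  by apply: (is_derive_eq (is_deriveM ft gt)); rewrite addrC -![_ *: _]/(_ * _) [g t * _]mulrC.
have h := is_deriveD (is_deriveM f'b g0) (is_deriveM f0 g'd).
by apply: (is_derive_eq h); rewrite -![_ *: _]/(_ * _) -f'0 -g'0; ring.
Unshelve. all: by end_near. Qed.

Lemma jet2_comp (F F1 : R -> R) f a b c :
  (\forall y \near f 0, is_derive (y : R) 1 F (F1 y)) ->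
  is_derive (f 0) 1 F1 c -> jet2 f a b ->
  jet2 (fun t => F (f t)) (F1 (f 0) * a) (c * a ^+ 2 + F1 (f 0) * b).
Proof.
move=> FF1 F1c [f' [ff' f'0 f'b]].
have f0 := nbhs_singleton ff'.
have cf : {for 0, continuous f}.
  by apply/differentiable_continuous/derivable1_diffP; case: f0.
exists (fun t => F1 (f t) * f' t); split; [|by rewrite f'0|].
  near=> t.
  have ft : is_derive (t : R) 1 f (f' t) by near: t.
  have Ft : is_derive (f t) 1 F (F1 (f t)) by near: t; exact: (cf _ FF1).
  exact: is_derive1_comp.
have h : is_derive (0 : R) 1 (F1 \o f) (c * f' 0) by exact: is_derive1_comp.
by apply: (is_derive_eq (is_deriveM h f'b)); rewrite ![_ *: _]mulrC f'0 /=; ring.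
Unshelve. all: by end_near. Qed.

Lemma jet2_expR f a b : jet2 f a b ->
  jet2 (fun t => expR (f t)) (expR (f 0) * a) (expR (f 0) * (a ^+ 2 + b)).
Proof.
move=> fab; rewrite mulrDr; apply: jet2_comp fab.
by near=> y; exact: is_derive_expR.
Unshelve. all: by end_near. Qed.

Lemma jet2_sqrt f a b (r := Num.sqrt (f 0)) : 0 < f 0 -> jet2 f a b ->
  jet2 (fun t => Num.sqrt (f t)) (a / (2 * r))
    (b / (2 * r) - a ^+ 2 / (4 * r ^+ 3)).
Proof.
move=> f0 fab; have r0 : 0 < r by rewrite sqrtr_gt0.
suff : jet2 (fun t => Num.sqrt (f t)) ((2 * r)^-1 * a)
    ((- (2 * r)^-2 * r^-1) * a ^+ 2 + (2 * r)^-1 * b).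
  by congr jet2; field; exact: lt0r_neq0.
apply: (@jet2_comp (@Num.sqrt R) (fun y => (2 * Num.sqrt y)^-1)) fab.
  near=> y; apply: is_derive1_sqrt; near: y.
  exact: lt_nbhsr.
have h1 : is_derive (f 0) 1 Num.sqrt (2 * r)^-1 by exact: is_derive1_sqrt.
have h2 : is_derive (f 0) 1 (fun y => 2 * Num.sqrt y) r^-1.
  apply: (is_derive_eq (is_deriveZ 2 h1)).
  by rewrite [_ *: _]mulrC; field; exact: lt0r_neq0.
have h3 : 2 * Num.sqrt (f 0) != 0 by rewrite mulf_neq0// gt_eqF.
have h4 : is_derive (f 0) 1 (fun y => (2 * Num.sqrt y)^-1) (- (2 * r) ^- 2 *: r^-1).
  exact: is_deriveV.
by apply: (is_derive_eq h4); rewrite [_ *: _]mulrC; field; exact: lt0r_neq0.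
Unshelve. all: by end_near. Qed.

(** The first claim is Fermat's rule. If [b] were positive, the derivative, which vanishes at [0],
    would be positive just to the right of it, and [f] would increase strictly there. *)
Lemma jet2_max f a b : (\forall t \near (0 : R), f t <= f 0) -> jet2 f a b ->
  a = 0 /\ b <= 0.
Proof.
move=> fmax [f' [ff' f'0 f'b]].
have : \forall t \near 0, f t <= f 0 /\ is_derive (t : R) 1 f (f' t).
  by near do split.
move=> /nbhs_ballP[e /= e0 H].
have {}H t : `|t| < e -> f t <= f 0 /\ is_derive (t : R) 1 f (f' t).
  by move=> te; apply: H; rewrite /ball /= sub0r normrN.
have a0 : a = 0.
  have d0 : is_derive (0 : R) 1 f 0.
    apply: (@derive1_at_max _ f (- e) e) => [|t|/=|t].
    - by rewrite ge0_cp// ltW.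
    - by rewrite in_itv/= -ltr_norml => /H[_ []].
    - by rewrite in_itv/= oppr_lt0 e0.
    - by rewrite in_itv/= -ltr_norml => /H[].
  have [_ d1] := d0; have [_ d2] : is_derive (0 : R) 1 f (f' 0) by exact: nbhs_singleton ff'.
  by rewrite -f'0 -d2 d1.
split => //; rewrite leNgt; apply/negP => b0.
have [e1 e10 H1] := gt0_is_derive_right f'b b0.
pose s := Num.min e e1 / 2.
have m0 : 0 < Num.min e e1 by rewrite lt_min e0.
have s0 : 0 < s by rewrite divr_gt0.
have se : s < Num.min e e1 by rewrite /s; lra.
have : f 0 < f s.
  apply: (@gtr0_derive1_incr _ f 0 s) => //.
  - move=> t; rewrite in_itv/= => /andP[t0 ts].
    have [|_ []//] := H t.
    by rewrite gtr0_norm// (lt_trans ts)// (lt_le_trans se)// ge_min lexx.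
  - move=> t; rewrite in_itv/= => /andP[t0 ts].
    have [|_ [_ d]] := H t.
      by rewrite gtr0_norm// (lt_trans ts)// (lt_le_trans se)// ge_min lexx.
    rewrite derive1E d.
    have := H1 t; rewrite add0r f'0 a0; apply; rewrite t0/=.
    by rewrite (lt_trans ts)// (lt_le_trans se)// ge_min lexx orbT.
  - apply: derivable_within_continuous => t; rewrite in_itv/= => /andP[t0 ts].
    have [|_ []//] := H t.
    by rewrite ger0_norm// (le_lt_trans ts)// (lt_le_trans se)// ge_min lexx.
have [|+ _] := H s; last by rewrite leNgt => /negP.
by rewrite gtr0_norm// (lt_le_trans se)// ge_min lexx.
Unshelve. all: by end_near. Qed.

End jets.

(** * Euclidean geometry and the maximum principle in the plane *)

Section plane.
Context {R : realType}.
Notation V := 'rV[R]_2.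
Implicit Types (x y z : V) (r s t : R).

Definition dot x y : R := \sum_(i < 2) x 0 i * y 0 i.

Lemma sum2E (f : 'I_2 -> R) : \sum_(i < 2) f i = f 0 + f 1.
Proof.
rewrite big_ord_recl big_ord_recl big_ord0 addr0.
by rewrite (_ : lift ord0 ord0 = 1 :> 'I_2)//; exact: val_inj.
Qed.

Lemma dotE x y : dot x y = x 0 0 * y 0 0 + x 0 1 * y 0 1.
Proof. exact: sum2E. Qed.

Lemma dot_basis i x : dot (basis_vec R i) x = x 0 i.
Proof.
rewrite /dot (bigD1 i)//= big1 ?addr0; first by rewrite mxE !eqxx mul1r.
by move=> j ji; rewrite mxE eqxx (negbTE ji) mul0r.
Qed.

Lemma enormE x : enorm x = Num.sqrt (dot x x).
Proof. by rewrite /enorm /dot. Qed.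

Lemma dot_ge0 x : 0 <= dot x x.
Proof. by rewrite dotE -!expr2 addr_ge0 ?sqr_ge0. Qed.

Lemma enorm_ge0 x : 0 <= enorm x.
Proof. exact: sqrtr_ge0. Qed.

Lemma sqr_enorm x : enorm x ^+ 2 = dot x x.
Proof. by rewrite enormE sqr_sqrtr ?dot_ge0. Qed.

(** Lagrange's identity: the difference of the squares is the square of the determinant of [x] and
    [y]. *)
Lemma dot_le x y : dot x y <= enorm x * enorm y.
Proof.
rewrite (le_trans (ler_norm _))// -ler_sqr ?nnegrE ?mulr_ge0 ?enorm_ge0//.
rewrite real_normK ?num_real// exprMn !sqr_enorm !dotE.
rewrite -subr_ge0 (_ : _ - _ = (x 0 0 * y 0 1 - x 0 1 * y 0 0) ^+ 2) ?sqr_ge0//.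
by ring.
Qed.

Lemma enormN x : enorm (- x) = enorm x.
Proof. by rewrite !enormE; congr Num.sqrt; rewrite !dotE !mxE; ring. Qed.

Lemma enormBC x y : enorm (x - y) = enorm (y - x).
Proof. by rewrite -enormN opprB. Qed.

Lemma enormZ r x : enorm (r *: x) = `|r| * enorm x.
Proof.
rewrite !enormE -sqrtr_sqr -sqrtrM ?sqr_ge0//.
by congr Num.sqrt; rewrite !dotE !mxE; ring.
Qed.

Lemma enorm0 : enorm (0 : V) = 0.
Proof. by rewrite -(scale0r (0 : V)) enormZ normr0 mul0r. Qed.

Lemma ler_enormD x y : enorm (x + y) <= enorm x + enorm y.
Proof.
rewrite -ler_sqr ?nnegrE ?addr_ge0 ?enorm_ge0// sqrrD !sqr_enorm.
rewrite (_ : dot (x + y) (x + y) = dot x x + dot x y *+ 2 + dot y y).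
  by rewrite lerD2r lerD2l lerMn2r dot_le orbT.
by rewrite !dotE !mxE; ring.
Qed.

Lemma ler_enormB x y z : enorm (x - z) <= enorm (x - y) + enorm (y - z).
Proof. by rewrite (le_trans _ (ler_enormD _ _))// addrA subrK. Qed.

Lemma enorm0_eq0 x : enorm x = 0 -> x = 0.
Proof.
move=> x0; have : dot x x == 0 by rewrite -sqr_enorm x0 expr0n.
rewrite dotE -!expr2 paddr_eq0 ?sqr_ge0// !sqrf_eq0 => /andP[/eqP h0 /eqP h1].
apply/rowP => i; rewrite mxE.
by case: i => [[|[|//]]] h; [rewrite -[RHS]h0|rewrite -[RHS]h1]; congr (x _ _); exact: val_inj.
Qed.

Lemma enorm_gt0 x : x != 0 -> 0 < enorm x.
Proof.
move=> x0; rewrite lt_neqAle enorm_ge0 andbT eq_sym.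
by apply: contra x0 => /eqP/enorm0_eq0 ->.
Qed.

Lemma coord_le_enorm x i : `|x 0 i| <= enorm x.
Proof.
rewrite /enorm -sqrtr_sqr ler_sqrt ?sumr_ge0// => [|j _]; rewrite ?sqr_ge0//.
by rewrite (bigD1 i)//= lerDl sumr_ge0// => j _; rewrite sqr_ge0.
Qed.

Lemma norm_le_enorm x : `|x| <= enorm x.
Proof.
rewrite /Num.norm /= mx_normrE; apply: bigmax_le => [|[i j] _]; first exact: enorm_ge0.
by rewrite ord1 /= coord_le_enorm.
Qed.

Lemma enorm_le_norm x : enorm x <= 2 * `|x|.
Proof.
have h i : `|x 0 i| <= `|x|.
  by rewrite [leRHS]/Num.norm /= mx_normrE; exact: (le_bigmax _ _ (0, i)).
rewrite -ler_sqr ?nnegrE ?enorm_ge0 ?mulr_ge0// sqr_enorm dotE -!expr2.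
rewrite -[x 0 0 ^+ 2]real_normK ?num_real// -[x 0 1 ^+ 2]real_normK ?num_real//.
have h2 i : `|x 0 i| ^+ 2 <= `|x| ^+ 2 by rewrite ler_sqr ?nnegrE.
by have := h2 0; have := h2 1; have := sqr_ge0 `|x|; lra.
Qed.

(** The topology comes from the sup norm; as the two norms are equivalent, neighbourhoods can be
    described by Euclidean discs. *)
Lemma nbhs_enormP x (A : set V) :
  nbhs x A <-> exists2 e, 0 < e & forall y, enorm (y - x) < e -> A y.
Proof.
split=> [/nbhs_normP[e /= e0 H]|[e e0 H]]; last first.
  apply/(nbhs_normP x A); exists (e / 2); rewrite /= ?divr_gt0// => y /= xy.
  apply: H; rewrite enormBC (le_lt_trans (enorm_le_norm _))//.
  by move: xy; rewrite /ball_ /=; lra.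
exists e => // y xy; apply: H; rewrite /ball_ /= (le_lt_trans (norm_le_enorm _))//.
by rewrite enormBC.
Qed.

Lemma closed_enorm_ball x r : closed [set y | enorm (y - x) <= r].
Proof.
move=> y cy; rewrite /= leNgt; apply/negP => ry.
have [|z [/= zr]] := cy [set z | enorm (z - y) < enorm (y - x) - r].
  by apply/nbhs_enormP; exists (enorm (y - x) - r); rewrite ?subr_gt0.
have := ler_enormB y z x; rewrite (enormBC z y); lra.
Qed.

Lemma continuous_enormP (f : V -> R) x :
  {for x, continuous f} <-> forall e, 0 < e -> exists2 d, 0 < d &
    forall y, enorm (y - x) < d -> `|f y - f x| < e.
Proof.
split=> [/cvgrPdist_lt cf e /cf /nbhs_enormP[d d0 H]|H].
  by exists d => // y /H; rewrite distrC.
apply/(@cvgrPdist_lt _ _ _ _ (nbhs_filter x)) => e /H [d d0 {}H].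
apply/nbhs_enormP; exists d => // y /H.
by rewrite distrC.
Qed.

Lemma continuous_enormB c : continuous (fun x => enorm (x - c)).
Proof.
move=> x; apply/continuous_enormP => e e0; exists e => // y yx.
rewrite (le_lt_trans _ yx)// ler_norml.
have := ler_enormB y x c; have := ler_enormB x y c; rewrite (enormBC x y).
by move=> *; apply/andP; split; lra.
Qed.

Lemma continuous_dot z : continuous (fun x => dot x z).
Proof.
move=> x; apply/continuous_enormP => e e0.
have n0 := enorm_ge0 z.
exists (e / (enorm z + 1)) => [|y]; first by rewrite divr_gt0// ltr_wpDl.
rewrite ltr_pdivlMr; last by rewrite ltr_wpDl.
have -> : dot y z - dot x z = dot (y - x) z by rewrite !dotE !mxE; ring.
move=> ye; have e1 := enorm_ge0 (y - x).
have h1 := dot_le (y - x) z.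
have h2 : - dot (y - x) z <= enorm (y - x) * enorm z.
  have -> : - dot (y - x) z = dot (x - y) z by rewrite !dotE !mxE; ring.
  by rewrite enormBC dot_le.
by rewrite ltr_norml; apply/andP; split; lra.
Qed.

Lemma compact_enorm (A : set V) c r :
  closed A -> (forall x, A x -> enorm (x - c) <= r) -> compact A.
Proof.
move=> cA H; apply: bounded_closed_compact => //.
exists (r + enorm c); split; first exact: num_real.
move=> M ltM x Ax; rewrite /= (le_trans (norm_le_enorm _))// (le_trans _ (ltW ltM))//.
have := ler_enormB x c 0; have := H x Ax; rewrite !subr0; lra.
Qed.

(** * Restriction to lines, jets in the plane and the minimum principle *)

Lemma line_is_derive (f : V -> R) x e t d : is_derive (x + t *: e) e f d ->
  is_derive t 1 (fun s => f (x + s *: e)) d.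
Proof.
have E : (fun h : R => h^-1 *: (f (h *: e + (x + t *: e)) - f (x + t *: e))) =
  (fun h : R => h^-1 *: (f (x + (h *: (1 : R) + t) *: e) - f (x + t *: e))).
  apply/funext => h; rewrite [h *: (1 : R)]mulr1 scalerDl.
  by rewrite addrCA [h *: e + _]addrC.
move=> [df <-]; split.
  by move: df; rewrite /derivable E.
by rewrite /derive E.
Qed.

(* [a i] and [b i] are the first and second partial derivatives of [f] along the
   [i]-th axis, the only ones entering the Laplacian. *)
Definition jets (f : V -> R) x (a b : 'I_2 -> R) := forall i,
  jet2 (fun t => f (x + t *: basis_vec R i)) (a i) (b i).

Lemma near_line (P : set V) x e : nbhs x P -> \forall t \near (0 : R), P (x + t *: e).
Proof.
move=> /nbhs_enormP[d d0 H]; apply/nbhs_normP.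
have e0 : 0 < enorm e + 1 by rewrite ltr_wpDl ?enorm_ge0.
exists (d / (enorm e + 1)) => /=; first by rewrite divr_gt0.
move=> t /=; rewrite /ball_ /= sub0r normrN ltr_pdivlMr// => td.
apply: H; rewrite addrC addKr enormZ (le_lt_trans _ td)// ler_wpM2l//.
by rewrite lerDl.
Qed.

Lemma C2_jets (A : set V) f x : open A -> C2_on A f -> A x ->
  jets f x (fun i => partial i f x) (fun i => partial i (partial i f) x).
Proof.
move=> oA [[_ f1] f2] Ax i.
exists (fun t => partial i f (x + t *: basis_vec R i)); split.
- have : nbhs x A by exact: open_nbhs_nbhs.
  move=> /near_line -/(_ (basis_vec R i)); apply: filterS => t At.
  apply: line_is_derive; have [df _] := f1 i _ At.
  by split.
- by rewrite scale0r addr0.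
- apply: line_is_derive; rewrite scale0r addr0.
  by have [_ /(_ i x Ax)[df _]] := f2 i; split.
Qed.

Lemma jets_ext (f g : V -> R) x a b : f =1 g -> jets f x a b -> jets g x a b.
Proof. by move=> /funext ->. Qed.

Lemma jets_cst (c : R) x : jets (cst c) x (fun=> 0) (fun=> 0).
Proof. by move=> i; exact: jet2_cst. Qed.

Lemma jets_dot x z : jets (fun y => dot y z) x (fun i => z 0 i) (fun=> 0).
Proof.
move=> i; rewrite (_ : (fun t => _) = (fun t => dot x z + t * z 0 i)).
  exact: jet2_affine.
apply/funext => t.
by rewrite -dot_basis !dotE !mxE; ring.
Qed.

Lemma jetsD (f g : V -> R) x a b c d : jets f x a b -> jets g x c d ->
  jets (fun y => f y + g y) x (fun i => a i + c i) (fun i => b i + d i).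
Proof. by move=> fx gx i; exact: jet2D. Qed.

Lemma jetsM (f g : V -> R) x a b c d : jets f x a b -> jets g x c d ->
  jets (fun y => f y * g y) x (fun i => a i * g x + f x * c i)
    (fun i => b i * g x + 2 * (a i * c i) + f x * d i).
Proof.
move=> fx gx i; have := jet2M (fx i) (gx i).
by rewrite scale0r addr0.
Qed.

Lemma jetsZ (f : V -> R) x a b (k : R) : jets f x a b ->
  jets (fun y => k * f y) x (fun i => k * a i) (fun i => k * b i).
Proof.
move=> fx i; have := jetsM (jets_cst k x) fx i.
by rewrite !(mul0r, mulr0, add0r).
Qed.

Lemma jets_expR (f : V -> R) x a b : jets f x a b ->
  jets (fun y => expR (f y)) x (fun i => expR (f x) * a i)
    (fun i => expR (f x) * (a i ^+ 2 + b i)).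
Proof.
by move=> fx i; have := jet2_expR (fx i); rewrite scale0r addr0.
Qed.

Lemma jets_sqrt (f : V -> R) x a b (r := Num.sqrt (f x)) :
  0 < f x -> jets f x a b ->
  jets (fun y => Num.sqrt (f y)) x (fun i => a i / (2 * r))
    (fun i => b i / (2 * r) - a i ^+ 2 / (4 * r ^+ 3)).
Proof.
move=> fx0 fx i; have := jet2_sqrt _ (fx i).
by rewrite scale0r addr0; exact.
Qed.

Lemma jets_sqr (c : V) x :
  jets (fun y => dot (y - c) (y - c)) x (fun i => 2 * (x - c) 0 i) (fun=> 2).
Proof.
(* Along the axis this is a quadratic polynomial in [t]; its leading term is written as a product of
   two affine functions so that [jet2M] applies. *)
move=> i; have -> : (fun t => dot (x + t *: basis_vec R i - c) (x + t *: basis_vec R i - c))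
   = (fun t => dot (x - c) (x - c) + t * (2 * (x - c) 0 i) + (0 + t * 1) * (0 + t * 1)).
  apply/funext => t.
  have -> : x + t *: basis_vec R i - c = (x - c) + t *: basis_vec R i by rewrite addrAC.
  rewrite -dot_basis.
  have h : dot (basis_vec R i) (basis_vec R i) = 1 by rewrite dot_basis mxE !eqxx.
  rewrite add0r mulr1 -[t * t]mulr1 -{2}h {h} !dotE.
  move: (basis_vec R i) (x - c) => e z.
  by rewrite !mxE; ring.
have := jet2D (jet2_affine (dot (x - c) (x - c)) (2 * (x - c) 0 i))
  (jet2M (jet2_affine 0 1) (jet2_affine 0 1)).
by rewrite !(mul0r, mulr0, add0r, addr0, mulr1).
Qed.

Lemma jets_max (f : V -> R) x a b : (\forall y \near x, f y <= f x) ->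
  jets f x a b -> forall i, a i = 0 /\ b i <= 0.
Proof.
move=> fx fj i; apply: (jet2_max _ (fj i)).
by rewrite scale0r addr0; exact: (near_line _ fx).
Qed.

(** At a negative minimum, which is interior, both pure second derivatives are nonnegative, against
    the strict sign of their sum. Strictness is asked only where [f] is negative: there the term
    [mu ^+ 2 * f] provides it, so no perturbation is required. *)
Lemma min_principle (K : set V) (f : V -> R) :
  compact K -> {within K, continuous f} ->
  (forall x, K x -> f x < 0 -> nbhs x K /\
    exists a b, jets f x a b /\ b 0 + b 1 < 0) ->
  forall x, K x -> 0 <= f x.
Proof.
move=> cK cf H x Kx.
have [c /set_mem Kc cmin] := compact_EVT_min (ex_intro _ x Kx) cK cf.
rewrite (le_trans _ (cmin _ (mem_set Kx)))// leNgt; apply/negP => fc0.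
have [nK [a [b [fj b0]]]] := H c Kc fc0.
have max : \forall y \near c, -1 * f y <= -1 * f c.
  by apply: filterS nK => y Ky; rewrite !mulN1r lerN2 cmin// mem_set.
have h i := (jets_max max (jetsZ (-1) fj) i).2.
have := h 0; have := h 1; lra.
Qed.

End plane.

(** * Comparison with barriers *)

Section solutions.
Context {R : realType}.
Notation V := 'rV[R]_2.
Implicit Types (x y z p e : V) (A : set V) (f h v : V -> R) (mu r s t : R).

Lemma laplacianE f x :
  laplacian f x = partial 0 (partial 0 f) x + partial 1 (partial 1 f) x.
Proof. exact: sum2E. Qed.

Lemma boundary_notin A x : open A -> boundary A x -> ~ A x.
Proof. by move=> oA [_ +] Ax; apply; rewrite /interior; exact: open_nbhs_nbhs. Qed.

Lemma closure_open A x : open A -> closure A x -> A x \/ boundary A x.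
Proof.
move=> oA cx; have [Ax|nAx] := pselect (A x); [by left|right; split => //].
by move=> /nbhs_singleton.
Qed.

Lemma bounded_closure_compact A : bounded_set A -> compact (closure A).
Proof.
move=> [M [_ /(_ (M + 1))]]; rewrite ltrDl ltr01 => /(_ isT) H.
apply: (compact_enorm (c := 0) (r := 2 * (M + 1))); first exact: closed_closure.
have : closure A `<=` closure [set y | enorm (y - 0) <= 2 * (M + 1)].
  apply: closureS => y Ay; rewrite /= subr0 (le_trans (enorm_le_norm _))//.
  by rewrite ler_pM2l//; exact: H.
by have <- := (closure_id _).1 (@closed_enorm_ball R 0 (2 * (M + 1))); exact.
Qed.

Lemma continuous_funD (T : topologicalType) (f g : T -> R) :
  continuous f -> continuous g -> continuous (fun x : T => f x + g x).
Proof. by move=> cf cg x; exact: (cvgD (cf x) (cg x)). Qed.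

Lemma continuous_funM (T : topologicalType) (f g : T -> R) :
  continuous f -> continuous g -> continuous (fun x : T => f x * g x).
Proof. by move=> cf cg x; exact: (cvgM (cf x) (cg x)). Qed.

Lemma continuous_cst (T : topologicalType) (c : R) : continuous (fun _ : T => c).
Proof. by move=> x; exact: cvg_cst. Qed.

Lemma continuous_post (g : R -> R) f :
  continuous g -> continuous f -> continuous (fun x => g (f x)).
Proof. by move=> gc fc x; exact: (continuous_comp (fc x) (gc (f x))). Qed.

(** * Mean value theorem along the axes and directional derivatives *)

Lemma line_MVT f x i (k : R) :
  (forall s, `|s| <= `|k| -> derivable f (x + s *: basis_vec R i) (basis_vec R i)) ->
  exists2 c, `|c| <= `|k| &
    f (x + k *: basis_vec R i) - f x = partial i f (x + c *: basis_vec R i) * k.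
Proof.
move=> H; set e := basis_vec R i; pose g t := f (x + t *: e).
have gd t : `|t| <= `|k| -> is_derive t 1 g (partial i f (x + t *: e)).
  by move=> tk; apply: line_is_derive; split => //; exact: H.
have cg a b : (forall t, a <= t <= b -> `|t| <= `|k|) -> {within `[a, b], continuous g}.
  move=> ab; apply: derivable_within_continuous => t; rewrite in_itv/= => /ab /gd.
  by case.
have g0 : g 0 = f x by rewrite /g scale0r addr0.
have [k0|k0] := leP 0 k.
  have ab t : 0 <= t <= k -> `|t| <= `|k|.
    by move=> /andP[t0 tk]; rewrite !ger0_norm.
  have [|c ck E] :=
    MVT_segment (f := g) (df := fun t => partial i f (x + t *: e)) k0 _ (cg _ _ ab).
    by move=> t; rewrite in_itv/= => /andP[t0 tk]; apply/gd/ab; rewrite !ltW.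
  exists c; first by apply: ab; move: ck; rewrite in_itv.
  by rewrite -g0 E subr0.
have ab t : k <= t <= 0 -> `|t| <= `|k|.
  by move=> /andP[kt t0]; rewrite !ler0_norm ?lerN2// ltW.
have [|c ck E] :=
  MVT_segment (f := g) (df := fun t => partial i f (x + t *: e)) (ltW k0) _ (cg _ _ ab).
  by move=> t; rewrite in_itv/= => /andP[t0 tk]; apply/gd/ab; rewrite !ltW.
exists c; first by apply: ab; move: ck; rewrite in_itv.
by apply: oppr_inj; rewrite opprB -g0 E; ring.
Qed.

Lemma vec_basis x : x = x 0 0 *: basis_vec R 0 + x 0 1 *: basis_vec R 1.
Proof.
apply/rowP => -[[|[|//]]] h; rewrite !mxE/= ?(mulr1, mulr0, addr0, add0r);
  by congr (x _ _); exact: val_inj.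
Qed.

Lemma enorm_basis i : enorm (basis_vec R i) = 1.
Proof.
by rewrite enormE dot_basis mxE !eqxx sqrtr1.
Qed.

(** Move from [x] to [x + t z] parallel to the first axis, then to the second. The mean value
    theorem on each leg yields partial derivatives at points near [x], and their continuity gives
    the limit. *)
Lemma C1_is_derive A f x z : open A -> C1_on A f -> A x ->
  is_derive x z f (dot (gradient f x) z).
Proof.
move=> oA [_ f1] Ax.
suff H : (fun t => t^-1 *: (f (t *: z + x) - f x)) @ 0^' --> dot (gradient f x) z.
  split; first by apply: cvgP H.
  by apply: cvg_lim H => //; exact: Rhausdorff.
apply/cvgrPdist_lt => eps eps0.
(* For [|t| * K < d] both legs stay within [d] of [x]; the summand [1] makes [K] positive and the
   final estimate strict. *)
have [K [K0 KE]] : exists K, 0 < K /\ K = `|z 0 0| + `|z 0 1| + 1.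
  by eexists; split; last reflexivity; rewrite ltr_wpDl ?addr_ge0.
have [d d0 Hd] : exists2 d, 0 < d & forall y, enorm (y - x) < d ->
    [/\ A y, `|partial 0 f y - partial 0 f x| < eps / K
      & `|partial 1 f y - partial 1 f x| < eps / K].
  have eK : 0 < eps / K by rewrite divr_gt0.
  have /nbhs_enormP[d d0 HA] : nbhs x A by exact: open_nbhs_nbhs.
  have [d1 d10 H1] := (continuous_enormP _ _).1 (f1 0 x Ax).2 _ eK.
  have [d2 d20 H2] := (continuous_enormP _ _).1 (f1 1 x Ax).2 _ eK.
  exists (Num.min d (Num.min d1 d2)); first by rewrite !lt_min d0 d10.
  move=> y; rewrite !lt_min => /and3P[yd yd1 yd2].
  by split; [exact: HA yd|exact: H1 yd1|exact: H2 yd2].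
apply/nbhs_normP; exists (d / K) => /=; first by rewrite divr_gt0.
move=> t; rewrite /ball_ /= sub0r normrN ltr_pdivlMr// => tK tn0.
set e0 := basis_vec R 0; set e1 := basis_vec R 1.
have near (s0 s1 : R) : `|s0| <= `|t * z 0 0| -> `|s1| <= `|t * z 0 1| ->
    enorm (x + s0 *: e0 + s1 *: e1 - x) < d.
  move=> h0 h1; rewrite addrAC [x + _]addrC addrK.
  rewrite (le_lt_trans (ler_enormD _ _))// !enormZ !enorm_basis !mulr1.
  rewrite (le_lt_trans _ tK)// KE; move: h0 h1; rewrite !normrM.
  by have := normr_ge0 t; lra.
have [|c0 c0h E0] := line_MVT (f := f) (x := x) (i := 0) (k := t * z 0 0).
  move=> s sk; have [|As _ _] := Hd (x + s *: e0); last exact: (f1 0 _ As).1.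
  by have := near s 0 sk; rewrite scale0r addr0 normr0; apply.
have [|c1 c1h E1] := line_MVT (f := f) (x := x + (t * z 0 0) *: e0) (i := 1) (k := t * z 0 1).
  move=> s sk; have [|As _ _] := Hd (x + (t * z 0 0) *: e0 + s *: e1); last exact: (f1 1 _ As).1.
  exact: near.
have Ez : t *: z + x = x + (t * z 0 0) *: e0 + (t * z 0 1) *: e1.
  by rewrite {1}(vec_basis z) scalerDr !scalerA addrC addrA.
have -> : f (t *: z + x) - f x =
    t * (partial 1 f (x + (t * z 0 0) *: e0 + c1 *: e1) * z 0 1 +
         partial 0 f (x + c0 *: e0) * z 0 0).
  by rewrite Ez -[LHS](subrKA (f (x + (t * z 0 0) *: e0))) E0 E1; ring.
rewrite [_ *: _]mulrA mulVf// mul1r dotE !mxE.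
have [|_ h0 _] := Hd (x + c0 *: e0).
  by have := near c0 0 c0h; rewrite scale0r addr0 normr0; apply.
have [|_ _ h1] := Hd (x + (t * z 0 0) *: e0 + c1 *: e1); first exact: near.
move: h0 h1; set P0 := partial 0 f _; set Q0 := partial 0 f _.
set P1 := partial 1 f _; set Q1 := partial 1 f _ => h0 h1.
rewrite distrC (_ : _ - _ = (P1 - Q1) * z 0 1 + (P0 - Q0) * z 0 0); last by ring.
rewrite (le_lt_trans (ler_normD _ _))// !normrM.
rewrite (@le_lt_trans _ _ (eps / K * `|z 0 1| + eps / K * `|z 0 0|))//.
  by apply: lerD; apply: ler_wpM2r; [exact: normr_ge0|exact: ltW h1|exact: normr_ge0|exact: ltW h0].
rewrite -mulrDr mulrAC ltr_pdivrMr; last exact: K0.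
by rewrite ltr_pM2l; [rewrite KE [ltLHS]addrC ltrDl|exact: eps0].
Qed.

(** Apply [min_principle] to [h - v]. Where it is negative the point is off the boundary, and the
    Laplacian of [h - v] is at most [mu ^+ 2 * (h - v) < 0]. *)
Lemma comparison_le A mu v h :
  open A -> bounded_set A -> 0 < mu -> classical_solution A mu v ->
  continuous h -> (forall x, boundary A x -> 1 <= h x) ->
  (forall x, A x -> exists a b, jets h x a b /\ b 0 + b 1 <= mu ^+ 2 * h x) ->
  forall x, closure A x -> v x <= h x.
Proof.
move=> oA bA mu0 [v2 vc vE v1] hc h1 hj x cx.
suff: 0 <= h x + -1 * v x by rewrite mulN1r subr_ge0.
apply: (min_principle (f := fun x => h x + -1 * v x) (bounded_closure_compact bA) _ _ cx)
  => [|y cy hy].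
  apply: (continuous_funD (T := subspace (closure A)) (f := h)); first exact: continuous_subspaceT.
  exact: (continuous_funM (@continuous_cst _ _) vc).
have [Ay|By] := closure_open oA cy; last first.
  by move: hy; rewrite v1// mulr1 subr_lt0 ltNge h1.
split.
  by apply: (filterS (@subset_closure _ A)); exact: open_nbhs_nbhs.
have [a [b [hab hb]]] := hj y Ay.
have J := jetsD hab (jetsZ (-1) (C2_jets oA v2 Ay)).
do 2 eexists; split; first exact: J.
have := vE y Ay; rewrite laplacianE => E.
move: E hb hy; rewrite -(pmulr_rlt0 _ (exprn_gt0 2 mu0)) /=.
move: (partial 0 _ y) (partial 1 _ y) (b 0) (b 1) (h y) (v y) (mu ^+ 2).
by move=> *; lra.
Qed.

Lemma comparison_ge A mu v h :
  open A -> bounded_set A -> 0 < mu -> classical_solution A mu v ->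
  continuous h -> (forall x, boundary A x -> h x <= 1) ->
  (forall x, A x -> exists a b, jets h x a b /\ mu ^+ 2 * h x <= b 0 + b 1) ->
  forall x, closure A x -> h x <= v x.
Proof.
move=> oA bA mu0 [v2 vc vE v1] hc h1 hj x cx.
suff: 0 <= v x + -1 * h x by rewrite mulN1r subr_ge0.
apply: (min_principle (f := fun x => v x + -1 * h x) (bounded_closure_compact bA) _ _ cx)
  => [|y cy hy].
  apply: (continuous_funD (T := subspace (closure A)) vc).
  apply: (continuous_funM (@continuous_cst _ _)); exact: continuous_subspaceT.
have [Ay|By] := closure_open oA cy; last first.
  by move: hy; rewrite v1// mulN1r subr_lt0 ltNge h1.
split.
  by apply: (filterS (@subset_closure _ A)); exact: open_nbhs_nbhs.
have [a [b [hab hb]]] := hj y Ay.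
have J := jetsD (C2_jets oA v2 Ay) (jetsZ (-1) hab).
do 2 eexists; split; first exact: J.
have := vE y Ay; rewrite laplacianE => E.
move: E hb hy; rewrite -(pmulr_rlt0 _ (exprn_gt0 2 mu0)) /=.
move: (partial 0 _ y) (partial 1 _ y) (b 0) (b 1) (h y) (v y) (mu ^+ 2).
by move=> *; lra.
Qed.

Lemma solution_le1 A mu v x : open A -> bounded_set A -> 0 < mu ->
  classical_solution A mu v -> closure A x -> v x <= 1.
Proof.
move=> oA bA mu0 sv; apply: (comparison_le (h := cst 1) oA bA mu0 sv) => //.
  exact: cst_continuous.
move=> y Ay; exists (fun=> 0), (fun=> 0); split; first exact: jets_cst.
by rewrite addr0 mulr1 sqr_ge0.
Qed.

(** As [e] is a unit vector, the exponential solves the equation exactly, and it is at most [1] on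
    the half-plane containing the closure of [A]. *)
Lemma solution_ge_halfplane A mu v p e y : open A -> bounded_set A -> 0 < mu ->
  classical_solution A mu v -> enorm e = 1 ->
  (forall x, closure A x -> 0 <= dot (x - p) e) ->
  closure A y -> expR (- mu * dot (y - p) e) <= v y.
Proof.
move=> oA bA mu0 sv e1 He.
have Ed x : dot (x - p) e = dot x e + - dot p e by rewrite !dotE !mxE; ring.
apply: (comparison_ge (h := fun y => expR (- mu * dot (y - p) e)) oA bA mu0 sv).
- apply: continuous_post; first exact: continuous_expR.
  apply: continuous_funM; first exact: continuous_cst.
  rewrite (_ : (fun x => _) = (fun x => dot x e - dot p e)); last exact/funext.
  by apply: continuous_funD; [exact: continuous_dot|exact: continuous_cst].
- move=> x [cx _]; rewrite -expR0 ler_expR.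
  by rewrite mulNr oppr_le0 mulr_ge0 ?He// ltW.
move=> x Ax.
have J := jets_expR (jetsZ (- mu) (jetsD (jets_dot x e) (jets_cst (- dot p e) x))).
do 2 eexists; split.
  by apply: jets_ext J => z /=; rewrite Ed.
rewrite /= -Ed; set E := expR _.
have := sqr_enorm e; rewrite e1 dotE => e2.
rewrite le_eqVlt; apply/orP; left; apply/eqP; transitivity (mu ^+ 2 * E * (1 ^+ 2)); first by ring.
by rewrite e2; ring.
Qed.

(** The left side is the Laplacian of [exp (a n)] divided by [exp (a n)], for [n] the root of
    [|y - x|^2 + s^2] and [d0], [d1] the coordinates of [y - x]. The two terms are at most [a ^+ 2]
    and [2 * a / s]. *)
Lemma barrier_bound (a s n d0 d1 : R) : 0 <= a -> 0 < s -> s <= n ->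
  n ^+ 2 = d0 * d0 + d1 * d1 + s ^+ 2 ->
  a ^+ 2 * (d0 ^+ 2 + d1 ^+ 2) / n ^+ 2 +
    a * (2 / n - (d0 ^+ 2 + d1 ^+ 2) / n ^+ 3) <= (a + s^-1) ^+ 2.
Proof.
move=> a0 s0 sn n2; have n0 : 0 < n by exact: lt_le_trans sn.
have Q : 0 <= d0 ^+ 2 + d1 ^+ 2 by rewrite addr_ge0 ?sqr_ge0.
have Q2 : d0 ^+ 2 + d1 ^+ 2 = n ^+ 2 - s ^+ 2 by rewrite n2; ring.
have h1 : a ^+ 2 * (d0 ^+ 2 + d1 ^+ 2) / n ^+ 2 <= a ^+ 2.
  rewrite ler_pdivrMr ?exprn_gt0// ler_wpM2l ?sqr_ge0// Q2.
  by rewrite gerBl sqr_ge0.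
have h2 : 2 / n - (d0 ^+ 2 + d1 ^+ 2) / n ^+ 3 <= 2 / s.
  rewrite (@le_trans _ _ (2 / n))//.
    by rewrite gerBl divr_ge0// exprn_ge0// ltW.
  by rewrite ler_pM2l// lef_pV2.
have h3 := ler_wpM2l a0 h2.
rewrite (le_trans (lerD h1 h3))// sqrrD.
by rewrite mulrCA mulr_natl lerDl sqr_ge0.
Qed.

(** The barrier is [exp (a (N - r))], where [N] is the distance to [x] smoothed at scale [s] and
    [a = mu - s^-1], so that [(a + s^-1) ^+ 2 = mu ^+ 2] in [barrier_bound]. On the boundary
    [N >= r] makes it at least [1]; at [x], where [N = s], it is the claimed bound. *)
Lemma solution_le_ball A mu v x r s : open A -> bounded_set A -> 0 < mu ->
  classical_solution A mu v -> A x -> 0 < s -> 1 <= mu * s ->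
  (forall y, ~ A y -> r <= enorm (y - x)) ->
  v x <= expR (- (mu - s^-1) * (r - s)).
Proof.
move=> oA bA mu0 sv Ax s0 mus Hr.
pose N y := Num.sqrt (dot (y - x) (y - x) + s ^+ 2).
pose a := mu - s^-1.
have a0 : 0 <= a by rewrite subr_ge0 -[s^-1]mul1r ler_pdivrMr.
have rad0 y : 0 < dot (y - x) (y - x) + s ^+ 2.
  by rewrite ltr_wpDl ?dot_ge0// exprn_gt0.
have Nx : N x = s.
  by rewrite /N subrr (_ : dot 0 0 = 0) ?add0r ?sqrtr_sqr ?gtr0_norm// dotE !mxE; ring.
have Ns y : s <= N y.
  rewrite -[leLHS]gtr0_norm// -sqrtr_sqr ler_sqrt ?lerDr ?dot_ge0//.
  exact: ltW.
have Nn y : enorm (y - x) <= N y.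
  by rewrite enormE ler_sqrt ?lerDl ?sqr_ge0// ltW.
have -> : - a * (r - s) = a * (N x - r) by rewrite Nx; ring.
apply: (comparison_le (h := fun y => expR (a * (N y - r))) oA bA mu0 sv).
- apply: continuous_post; first exact: continuous_expR.
  apply: continuous_funM; first exact: continuous_cst.
  apply: continuous_funD; last exact: continuous_cst.
  apply: continuous_post; first exact: sqrt_continuous.
  apply: continuous_funD; last exact: continuous_cst.
  rewrite (_ : (fun y => _) = (fun y => enorm (y - x) * enorm (y - x))).
    by apply: continuous_funM; exact: continuous_enormB.
  by apply/funext => z; rewrite -expr2 sqr_enorm.
- move=> y By; rewrite -expR0 ler_expR mulr_ge0// subr_ge0.
  by rewrite (le_trans (Hr _ (boundary_notin oA By))).
- move=> y Ay.
  have JN := jets_sqrt (rad0 y) (jetsD (jets_sqr x y) (jets_cst (s ^+ 2) y)).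
  have J := jets_expR (jetsZ a (jetsD JN (jets_cst (- r) y))).
  do 2 eexists; split; first exact: J.
  rewrite /= -/(N y); set E := expR _.
  have N0 : 0 < N y by exact: lt_le_trans s0 (Ns y).
  have N2 : N y ^+ 2 = (y - x) 0 0 * (y - x) 0 0 + (y - x) 0 1 * (y - x) 0 1 + s ^+ 2.
    by rewrite sqr_sqrtr ?dotE// -dotE ltW.
  set n := N y in N0 N2 *; set d0 := (y - x) 0 0 in N2 *; set d1 := (y - x) 0 1 in N2 *.
  have ns : s <= n by exact: Ns.
  rewrite -mulrDr [leRHS]mulrC ler_wpM2l ?expR_ge0//.
  have := barrier_bound a0 s0 ns N2; rewrite /a subrK -/a; apply: le_trans.
  rewrite le_eqVlt; apply/orP; left; apply/eqP.
  by move: (lt0r_neq0 N0) => n0; field.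
- exact: subset_closure.
Qed.

End solutions.

(** * Convex domains *)

Section convex_domains.
Context {R : realType}.
Notation V := 'rV[R]_2.
Implicit Types (x y z p w : V) (A : set V) (f v : V -> R) (mu r s t : R).

Lemma convex_set_segP A : convex_set A <->
  forall x y t, A x -> A y -> 0 <= t <= 1 -> A (x + t *: (y - x)).
Proof.
have E x y t : x + t *: (y - x) = t *: y + (1 - t) *: x.
  by rewrite scalerBr scalerBl scale1r addrC -addrA [- _ + x]addrC.
split=> [cA x y t Ax Ay /andP[t0 t1]|cA x y t /set_mem Ax /set_mem Ay].
  have /set_mem := cA y x (Itv01 t0 t1) (mem_set Ay) (mem_set Ax).
  by rewrite E.
apply/mem_set; have := cA y x t%:num Ay Ax; rewrite E; apply.
by rewrite ge0 le1.
Qed.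

Lemma dotNr x y : dot x (- y) = - dot x y.
Proof. by rewrite !dotE !mxE; ring. Qed.

Lemma closure_enormP A x :
  closure A x <-> forall e, 0 < e -> exists2 y, A y & enorm (y - x) < e.
Proof.
split=> [cx e e0|H B /nbhs_enormP[e e0 BH]].
  have [|y [Ay ye]] := cx [set y | enorm (y - x) < e]; last by exists y.
  by apply/nbhs_enormP; exists e.
by have [y Ay /BH By] := H e e0; exists y.
Qed.

Lemma within_enormP A f :
  {within A, continuous f} <-> forall x, A x -> forall e, 0 < e ->
    exists2 d, 0 < d & forall y, A y -> enorm (y - x) < d -> `|f y - f x| < e.
Proof.
rewrite subspace_continuousP; split=> [cf x Ax e e0|H x Ax].
  have /cvgrPdist_lt /(_ _ e0) := cf x Ax.
  rewrite near_withinE => /nbhs_enormP[d d0 Hd].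
  by exists d => // y Ay /Hd; rewrite distrC; exact.
apply/cvgrPdist_lt => e e0; rewrite near_withinE.
have [d d0 Hd] := H x Ax e e0.
by apply/nbhs_enormP; exists d => // y yx Ay; rewrite distrC; exact: Hd.
Qed.

Lemma convex_closure_seg A x y t : convex_set A -> closure A x -> closure A y ->
  0 <= t <= 1 -> closure A (x + t *: (y - x)).
Proof.
move=> /convex_set_segP cA /closure_enormP cx /closure_enormP cy t01.
apply/closure_enormP => e e0; have e2 : 0 < e / 2 by rewrite divr_gt0.
have [x' Ax' xx'] := cx _ e2; have [y' Ay' yy'] := cy _ e2.
exists (x' + t *: (y' - x')); first exact: cA.
have -> : x' + t *: (y' - x') - (x + t *: (y - x)) =
    (1 - t) *: (x' - x) + t *: (y' - y).
  by apply/rowP => i; rewrite !mxE; ring.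
move/andP: t01 => [t0 t1].
rewrite (le_lt_trans (ler_enormD _ _))// !enormZ.
rewrite (ger0_norm t0) ger0_norm ?subr_ge0//.
have h1 : (1 - t) * enorm (x' - x) <= 1 * enorm (x' - x).
  by rewrite ler_wpM2r ?enorm_ge0// gerBl.
have h2 : t * enorm (y' - y) <= 1 * enorm (y' - y) by rewrite ler_wpM2r ?enorm_ge0.
lra.
Qed.

(* Take a point just beyond [x] on a ray from a point [y] of [A]: if it were in
   the closure of [A], then [x] would be in the interior of [A]. *)
Lemma convex_exterior A x d : open A -> convex_set A -> boundary A x -> 0 < d ->
  exists2 z, enorm (z - x) < d & ~ closure A z.
Proof.
move=> oA /convex_set_segP cA Bx d0.
have [y Ay _] := (closure_enormP A x).1 Bx.1 1 ltr01.
have K0 : 0 < enorm (x - y) + 1 by rewrite ltr_wpDl ?enorm_ge0.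
pose s := d / (enorm (x - y) + 1).
have s0 : 0 < s by rewrite divr_gt0.
exists (x + s *: (x - y)) => [|/closure_enormP cz].
  rewrite addrC addKr enormZ gtr0_norm// /s mulrAC ltr_pdivrMr//.
  by rewrite ltr_pM2l// ltrDl.
have /nbhs_enormP[r r0 Hr] : nbhs y A by exact: open_nbhs_nbhs.
have [z' Az' zz'] := cz _ (mulr_gt0 r0 s0).
apply: (boundary_notin oA Bx).
(* The line from [z'] through [x] is prolonged in the ratio in which [x] divides the segment from
   [z] to [y]. The distance from [y'] to [y] is that from [z'] to [z] divided by [s], hence below
   [r]. *)
pose y' := y + s^-1 *: (x + s *: (x - y) - z').
have Ay' : A y'.
  apply: Hr; rewrite /y' addrC addKr enormZ gtr0_norm ?invr_gt0//.
  by rewrite mulrC ltr_pdivrMr// enormBC.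
have s1 : 0 < 1 + s by rewrite addr_gt0.
have -> : x = z' + (s / (1 + s)) *: (y' - z').
  by apply/rowP => i; rewrite !mxE; field; rewrite !lt0r_neq0.
apply: cA => //; apply/andP; split; first by rewrite divr_ge0// ltW.
by rewrite ler_pdivrMr// mul1r lerDr.
Qed.

(** Take [p] nearest to [z] in the closure and [e] the direction from [z] to [p]. A point [w] on the
    wrong side of the line through [p] normal to [e] would give points nearer to [z] on the segment
    from [p] to [w]. *)
Lemma convex_projection A z : A !=set0 -> bounded_set A -> convex_set A ->
  ~ closure A z ->
  exists p e, [/\ closure A p, enorm e = 1,
    (forall w, closure A w -> 0 <= dot (w - p) e) &
    (forall w, closure A w -> enorm (p - z) <= enorm (w - z))].
Proof.
move=> [a Aa] bA cA nz.
have cK := bounded_closure_compact bA.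
have ca : closure A a by exact: subset_closure.
have [p /set_mem cp pmin] := compact_EVT_min (ex_intro _ a ca) cK
  (continuous_subspaceT (@continuous_enormB R z)).
have {}pmin w : closure A w -> enorm (p - z) <= enorm (w - z).
  by move=> cw; apply: pmin; exact: mem_set.
have n0 : 0 < enorm (p - z).
  apply: enorm_gt0; rewrite subr_eq0; apply/negP => /eqP pz.
  by apply: nz; rewrite -pz.
exists p, ((enorm (p - z))^-1 *: (p - z)); split => //.
  by rewrite enormZ gtr0_norm ?invr_gt0// mulVf// gt_eqF.
move=> w cw.
have -> : dot (w - p) ((enorm (p - z))^-1 *: (p - z)) =
   (enorm (p - z))^-1 * dot (w - p) (p - z).
  by rewrite !dotE !mxE; ring.
rewrite mulr_ge0 ?invr_ge0 ?enorm_ge0// leNgt; apply/negP => neg.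
set m := - dot (w - p) (p - z); have m0 : 0 < m by rewrite oppr_gt0.
have q0 : 0 <= dot (w - p) (w - p) by exact: dot_ge0.
set q := dot (w - p) (w - p) in q0.
have H t : 0 <= t <= 1 -> 2 * t * m <= t ^+ 2 * q.
  move=> t01; have := pmin _ (convex_closure_seg cA cp cw t01).
  rewrite -ler_sqr ?nnegrE ?enorm_ge0// !sqr_enorm -subr_ge0 /m /q.
  rewrite (_ : _ - _ = 2 * t * dot (w - p) (p - z) + t ^+ 2 * dot (w - p) (w - p)).
    by move=> ge0; rewrite mulrN lerNl -subr_ge0 opprK.
  by rewrite !dotE !mxE; ring.
(* With this [t], [H] reduces to [2 * m <= t * q = m - t * m], which is impossible. *)
pose t := m / (m + q).
have mq : 0 < m + q by rewrite ltr_wpDr.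
have t0 : 0 < t by rewrite divr_gt0.
have := H t; rewrite (ltW t0)/= ler_pdivrMr// mul1r lerDl q0 => /(_ isT).
have tmq : t * (m + q) = m by rewrite divfK// gt_eqF.
have -> : 2 * t * m = t * (2 * m) by ring.
have -> : t ^+ 2 * q = t * (t * q) by ring.
rewrite ler_pM2l// => le_tq.
have := mulr_gt0 t0 m0; move: tmq; rewrite mulrDr; lra.
Qed.

(** Project a point [z] outside the closure, within [d] of [x], to [p]. As [|p - z| <= |x - z| < d],
    the point [p] is within [2 * d] of [x]; apply the half-plane bound at [p] and let [d] tend to
    [0]. *)
Lemma convex_solution_ge A mu v x y : domain A -> bounded_set A -> 0 < mu ->
  classical_solution A mu v -> convex_set A -> boundary A x -> closure A y ->
  expR (- (mu * enorm (y - x))) <= v y.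
Proof.
move=> [A0 oA _] bA mu0 sv cA Bx cy.
have H d : 0 < d -> expR (- (mu * (enorm (y - x) + 2 * d))) <= v y.
  move=> d0; have [z zd nz] := convex_exterior oA cA Bx d0.
  have [p [e [cp e1 pe pmin]]] := convex_projection A0 bA cA nz.
  apply: (le_trans _ (solution_ge_halfplane oA bA mu0 sv e1 pe cy)).
  rewrite ler_expR mulNr lerN2 ler_pM2l//.
  rewrite (le_trans (dot_le _ _))// e1 mulr1.
  have := pmin x Bx.1; have := ler_enormB y x p; have := ler_enormB x z p.
  rewrite (enormBC z p) (enormBC x z); lra.
have v0 : 0 < v y by rewrite (lt_le_trans _ (H 1 ltr01))// expR_gt0.
rewrite -[leRHS]lnK ?posrE// ler_expR lerNl.
apply/ler_addgt0Pr => d d0.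
have := H (d / (2 * mu)); rewrite divr_gt0 ?mulr_gt0// => /(_ isT).
rewrite -[leRHS]lnK ?posrE// ler_expR lerNl; congr (_ <= _).
by field; exact: lt0r_neq0.
Qed.

Lemma jets_shift f x z a b : jets f (x + z) a b ->
  jets (fun y => f (y + z)) x a b.
Proof.
move=> H i; have := H i; congr jet2.
by apply/funext => t; rewrite addrAC.
Qed.

(** Minimum principle for [c * v (y + h) - v y]. If [y + h] is on the boundary, use [c >= 1 >= v y];
    if [y] is, use [convex_solution_ge], whose bound at [y + h] is exactly [c^-1]. Elsewhere the
    difference solves the same equation. *)
Lemma convex_solution_harnack A mu v x (h : V) : domain A -> bounded_set A -> 0 < mu ->
  classical_solution A mu v -> convex_set A -> A x -> A (x + h) ->
  v x <= expR (mu * enorm h) * v (x + h).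
Proof.
move=> dA bA mu0 sv cA Ax Axh; have [_ oA _] := dA; have [v2 vc vE v1] := sv.
set c := expR _; have c1 : 1 <= c.
  by rewrite -expR0 ler_expR mulr_ge0 ?enorm_ge0// ltW.
have c0 : 0 < c by exact: expR_gt0.
pose K := closure A `&` [set y | closure A (y + h)].
have shift_nbhs B y : nbhs (y + h) B -> nbhs y [set z | B (z + h)].
  move=> /nbhs_enormP[d d0 Hd]; apply/nbhs_enormP; exists d => // z zy.
  by apply: Hd; rewrite opprD addrACA subrr addr0.
have cK : compact K.
  apply: (subclosed_compact _ (bounded_closure_compact bA)) => [|y []//].
  apply: closedI; first exact: closed_closure.
  move=> y /closure_enormP Hy; apply/closure_enormP => e e0.
  have e2 : 0 < e / 2 by rewrite divr_gt0.
  have [z /closure_enormP Hz zy] := Hy _ e2; have [w Aw wz] := Hz _ e2.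
  exists w => //; have := ler_enormB w (z + h) (y + h).
  rewrite (_ : z + h - (y + h) = z - y); last by rewrite opprD addrACA subrr addr0.
  by lra.
suff: 0 <= c * v (x + h) + -1 * v x by rewrite mulN1r subr_ge0.
apply: (min_principle (f := fun x => c * v (x + h) + -1 * v x) cK).
- apply: (continuous_funD (T := subspace K)).
    apply: (continuous_funM (@continuous_cst _ _ _)).
    apply/(within_enormP K (fun x => v (x + h))) => y [_ Ky] e e0.
    have [d d0 Hd] := (within_enormP _ _).1 vc _ Ky e e0.
    exists d => // z [_ Kz] zy; apply: Hd => //.
    by rewrite opprD addrACA subrr addr0.
  apply: (continuous_funM (@continuous_cst _ _ _)).
  by apply: (continuous_subspaceW _ vc) => y [].
- move=> y [cy cyh] neg.
  have [Byh|Ayh] : boundary A (y + h) \/ A (y + h).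
  + by have [] := closure_open oA cyh; [right|left].
  + move: neg; rewrite v1// mulr1 mulN1r subr_lt0 ltNge.
    by rewrite (le_trans (solution_le1 oA bA mu0 sv cy)).
  have [Ay|By] := closure_open oA cy; last first.
    move: neg; rewrite (v1 y)// mulr1 subr_lt0 ltNge.
    have := convex_solution_ge dA bA mu0 sv cA By cyh.
    rewrite addrC addKr expRN -/c => hv.
    by rewrite -(mulfV (lt0r_neq0 c0)) ler_pM2l// hv.
  split.
    have n1 : nbhs y A by exact: open_nbhs_nbhs.
    have n2 : nbhs y [set z | A (z + h)].
      by apply: shift_nbhs; exact: open_nbhs_nbhs.
    apply: (@filterS _ (nbhs y) _ _ _ _ (filterI n1 n2)) => z [Az Azh].
    by split; exact: subset_closure.
  have J := jetsD (jetsZ c (jets_shift (C2_jets oA v2 Ayh)))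
    (jetsZ (-1) (C2_jets oA v2 Ay)).
  do 2 eexists; split; first exact: J.
  have := vE _ Ay; have := vE _ Ayh; rewrite !laplacianE.
  move: neg; rewrite -(pmulr_rlt0 _ (exprn_gt0 2 mu0)) /=.
  move: (partial 0 _ y) (partial 1 _ y) (partial 0 _ (y + h)) (partial 1 _ (y + h)).
  move: (v y) (v (y + h)) (mu ^+ 2) => a b m d0 d1 d2 d3 neg e1 e2.
  have -> : c * d2 + -1 * d0 + (c * d3 + -1 * d1) = c * (d2 + d3) - (d0 + d1) by ring.
  by move/subr0_eq: e1 => ->; move/subr0_eq: e2 => ->; move: neg; congr (_ < _); ring.
- by split; apply: subset_closure.
Qed.

Lemma solution_ge0 A mu v x : open A -> bounded_set A -> 0 < mu ->
  classical_solution A mu v -> closure A x -> 0 <= v x.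
Proof.
move=> oA bA mu0 sv; apply: (comparison_ge (h := cst 0) oA bA mu0 sv) => //.
  exact: cst_continuous.
move=> y Ay; exists (fun=> 0), (fun=> 0); split; first exact: jets_cst.
by rewrite addr0 mulr0.
Qed.

(** If the bound failed, [phi] would vanish at [0] with positive derivative there, whereas the
    preceding inequality with [h = - t g] makes it nonpositive for small [t > 0]. *)
Lemma convex_gradient_le A mu v x : domain A -> bounded_set A -> 0 < mu ->
  classical_solution A mu v -> convex_set A -> A x ->
  enorm (gradient v x) <= mu * v x.
Proof.
move=> dA bA mu0 sv cA Ax; have [_ oA _] := dA; have [[v2 _] _ _ _] := sv.
rewrite leNgt; apply/negP; set g := gradient v x => gt.
have vx0 : 0 <= v x by apply: (solution_ge0 oA bA mu0 sv); exact: subset_closure.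
have g0 : 0 < enorm g by rewrite (le_lt_trans _ gt)// mulr_ge0// ltW.
pose k := - (mu * enorm g).
pose phi t := v x * expR (0 + t * k) + -1 * v (x + t *: (- g)).
have d1 : is_derive (0 : R) 1 (fun t => v (x + t *: (- g))) (- enorm g ^+ 2).
  apply: line_is_derive; rewrite scale0r addr0.
  apply: (is_derive_eq (C1_is_derive (- g) oA v2 Ax)).
  by rewrite dotNr sqr_enorm.
have d2 : is_derive (0 : R) 1 (fun t => expR (0 + t * k)) k.
  have := is_derive1_comp (is_derive_expR _) (is_derive_affine 0 k 0).
  by rewrite mul0r addr0 expR0 mul1r.
have d3 : is_derive (0 : R) 1 phi (enorm g * (enorm g - mu * v x)).
  apply: (is_derive_eq (is_deriveD (is_deriveZ (v x) d2) (is_deriveZ (-1) d1))).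
  have : v x * k + -1 * (- enorm g ^+ 2) = enorm g * (enorm g - mu * v x).
    by rewrite /k; ring.
  exact.
have [|e e0 He] := gt0_is_derive_right d3; first by rewrite mulr_gt0 ?subr_gt0.
have phi0 : phi 0 = 0.
  by rewrite /phi mul0r addr0 expR0 scale0r addr0 mulr1 mulN1r subrr.
have /near_line -/(_ (- g)) /nbhs_ballP[d /= d0 Hd] : nbhs x A by exact: open_nbhs_nbhs.
pose t := Num.min e d / 2.
have m0 : 0 < Num.min e d by rewrite lt_min e0.
have t0 : 0 < t by rewrite divr_gt0.
have : t < Num.min e d by rewrite /t; lra.
rewrite lt_min => /andP[te td].
have At : A (x + t *: - g) by apply: Hd; rewrite /ball/= sub0r normrN gtr0_norm.
have := He t; rewrite t0 te => /(_ isT); rewrite phi0 add0r /phi mulN1r subr_gt0.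
apply/negP; rewrite -leNgt.
have := convex_solution_harnack dA bA mu0 sv cA Ax At.
rewrite enormZ enormN gtr0_norm// => hv.
rewrite add0r (_ : t * k = - (mu * (t * enorm g))); last by rewrite /k; ring.
by rewrite expRN ler_pdivrMr ?expR_gt0// mulrC.
Qed.

End convex_domains.

(** * Discs touching the complement of a nonconvex open set *)

Section touching_disc.
Context {R : realType}.
Notation V := 'rV[R]_2.
Implicit Types (a b c x y z p q u w : V) (A : set V) (r s t : R).

Definition seg_in A x y := forall t, 0 <= t <= 1 -> A (x + t *: (y - x)).

Lemma seg_inC A x y : seg_in A x y -> seg_in A y x.
Proof.
move=> H t t01; have := H (1 - t); rewrite subr_ge0 gerBl andbC => /(_ t01).
by congr A; apply/rowP => i; rewrite !mxE; ring.
Qed.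

Lemma seg_in_near A x : open A -> A x ->
  exists2 d, 0 < d & forall y, enorm (y - x) < d -> seg_in A x y.
Proof.
move=> oA Ax; have /nbhs_enormP[d d0 Hd] : nbhs x A by exact: open_nbhs_nbhs.
exists d => // y yx t /andP[t0 t1]; apply: Hd.
rewrite addrC addKr enormZ ger0_norm// (le_lt_trans _ yx)//.
by rewrite ler_piMl ?enorm_ge0.
Qed.

Lemma seg_in1 A x y : seg_in A x y -> A y.
Proof. by move=> /(_ 1); rewrite ler01 lexx scale1r addrC subrK; exact. Qed.

(* In a connected open set in which being joined by a segment is transitive,
   the set of points seen from a given point is both open and closed. *)
Lemma nonconvex_triangle A : open A -> connected A -> ~ convex_set A ->
  exists a b c q, [/\ seg_in A b a, seg_in A b c, ~ A q
    & exists2 t, 0 <= t <= 1 & q = a + t *: (c - a)].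
Proof.
move=> oA cA; apply: contra_notP => H.
have {H} tr a b c : seg_in A b a -> seg_in A b c -> seg_in A a c.
  move=> ba bc t t01; apply: contrapT => nA; apply: H.
  by exists a, b, c, (a + t *: (c - a)); split => //; exists t.
apply/convex_set_segP => a y t Aa Ay t01.
suff : [set z | A z /\ seg_in A a z] = A.
  by move/seteqP => [_ /(_ _ Ay)[_]]; exact.
set S := [set z | _].
have step z z' : A z -> A z' -> seg_in A z z' -> S z -> S z'.
  move=> Az Az' zz' [_ az]; split => //.
  by apply: tr zz'; exact: seg_inC.
apply: cA.
- exists a; split => // s _; rewrite subrr scaler0 addr0.
  exact: Aa.
- exists S; last by apply/seteqP; split => [z Sz|z []//]; split => //; case: Sz.
  rewrite openE => z Sz; have [d d0 Hd] := seg_in_near oA Sz.1.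
  apply/nbhs_enormP; exists d => // z' /Hd zz'.
  by apply: (step z) => //; [case: Sz|exact: seg_in1 zz'].
- exists (closure S); first exact: closed_closure.
  apply/seteqP; split => [z Sz|z [Az cz]].
    by split; [case: Sz|exact: subset_closure].
  have [d d0 Hd] := seg_in_near oA Az.
  have [z' Sz' zz'] := (closure_enormP _ _).1 cz _ d0.
  apply: (step z' z) => //; first by case: Sz'.
  by apply: seg_inC; exact: Hd.
Qed.

(** * Triangles, barycentric coordinates and the touching disc *)

Definition cross x y := x 0 0 * y 0 1 - x 0 1 * y 0 0.

(** The clockwise quarter turn, which turns the determinant [cross] into a scalar product. *)
Definition rot x : V := \row_i (if i == 0 then x 0 1 else - x 0 0).

Lemma dot_rot x y : dot x (rot y) = cross x y.
Proof. by rewrite dotE !mxE /= mulrN. Qed.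

Lemma dot_eq0 x : dot x x = 0 -> x = 0.
Proof. by move=> x0; apply: enorm0_eq0; rewrite enormE x0 sqrtr0. Qed.

Lemma cross0_colinear u w : dot u u != 0 -> cross u w = 0 ->
  w = (dot u w / dot u u) *: u.
Proof.
move=> n0 uw; apply/rowP => i; rewrite mxE; apply: (mulIf n0).
rewrite mulrAC divfK//; apply/subr0_eq.
rewrite (_ : _ - _ = (if i == 0 then - u 0 1 else u 0 0) * cross u w).
  by rewrite uw mulr0.
case: i => [[|[|//]]] h /=.
  have -> : Ordinal h = 0 by exact: val_inj.
  by rewrite !dotE /cross; ring.
have -> : Ordinal h = 1 by exact: val_inj.
by rewrite !dotE /cross; ring.
Qed.

(** For a degenerate triangle with [a] distinct from [b], write [c = b + l (a - b)] and
    [q = b + m (a - b)]. Either [0 <= m <= 1] and [q] lies between [b] and [a], or [m < 0] forces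
    [l < 0], or [m > 1] forces [l > 1]; then [0 <= m / l <= 1] and [q] lies between [b] and [c]. *)
Lemma collinear_seg A a b c q t : seg_in A b a -> seg_in A b c ->
  0 <= t <= 1 -> q = a + t *: (c - a) -> cross (a - b) (c - b) = 0 -> A q.
Proof.
move=> ba bc /andP[t0 t1] -> det0.
have [/dot_eq0 u0|n0] := eqVneq (dot (a - b) (a - b)) 0.
  have -> : a + t *: (c - a) = b + t *: (c - b).
    by move/subr0_eq: u0 => ->.
  by apply: bc; rewrite t0.
pose l := dot (a - b) (c - b) / dot (a - b) (a - b).
have wE : c - b = l *: (a - b) by exact: cross0_colinear.
pose m := 1 - t + t * l.
have qa : a + t *: (c - a) = b + m *: (a - b).
  have -> : c - a = (c - b) - (a - b) by rewrite opprB addrA subrK.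
  by rewrite wE; apply/rowP => i; rewrite !mxE /m; ring.
have qc : l != 0 -> a + t *: (c - a) = b + (m / l) *: (c - b).
  by move=> l0; rewrite wE scalerA divfK.
have [m1|m1] := leP m 1.
  have [m0|m0] := leP 0 m; first by rewrite qa; apply: ba; rewrite m0.
  have l0 : l < 0 by rewrite ltNge; apply/negP => l0; have := mulr_ge0 t0 l0; rewrite /m in m0; lra.
  rewrite qc ?lt_eqF//; apply: bc; apply/andP; split.
    by rewrite mulr_le0// ?invr_le0 ltW.
  by rewrite ler_ndivrMr// mul1r /m; nra.
have l1 : 1 < l by rewrite ltNge; apply/negP => l1; have := ler_wpM2l t0 l1; rewrite /m in m1; lra.
have l0 : 0 < l by rewrite (lt_trans _ l1).
rewrite qc ?gt_eqF//; apply: bc; apply/andP; split.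
  by rewrite divr_ge0 ?ltW// (lt_trans _ m1).
by rewrite ler_pdivrMr// mul1r /m; nra.
Qed.

Lemma closed_dot_ge z (k : R) : closed [set y | k <= dot y z].
Proof.
apply: (@preimage_closed _ _ (fun y => dot y z) [set t | k <= t]).
  by move=> y _; exact: continuous_dot.
exact: closed_ge.
Qed.

Lemma nbhs_dot_gt z (k : R) p : k < dot p z -> nbhs p [set y | k < dot y z].
Proof. by move=> kp; have := @continuous_dot R z p _ (lt_nbhsr kp); exact. Qed.

Lemma seg_extend A b a : open A -> seg_in A b a -> exists2 d, 0 < d &
  forall t, 0 <= t <= 1 + d -> A (b + t *: (a - b)).
Proof.
move=> oA ba; have Aa := seg_in1 ba.
have /nbhs_enormP[d d0 Hd] : nbhs a A by exact: open_nbhs_nbhs.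
have n0 : 0 < enorm (a - b) + 1 by rewrite ltr_wpDl ?enorm_ge0.
exists (d / (enorm (a - b) + 1)) => [|t /andP[t0 t1]]; first by rewrite divr_gt0.
have [le1|gt1] := leP t 1; first by apply: ba; rewrite t0.
apply: Hd.
have -> : b + t *: (a - b) - a = (t - 1) *: (a - b).
  by apply/rowP => i; rewrite !mxE; ring.
rewrite enormZ gtr0_norm ?subr_gt0//.
have : (t - 1) * (enorm (a - b) + 1) <= d by rewrite -ler_pdivlMr// lerBlDl.
have : 0 < t - 1 by rewrite subr_gt0.
by rewrite mulrDr mulr1; lra.
Qed.

(* The complement of [A] meets the triangle [b, a, c] enlarged slightly beyond
   its side [a, c]. With [g] the gradient of the sum of the barycentric
   coordinates at [a] and [c], we maximise [eps |y - b|^2 - dot (y - b) g] over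
   the complement in this triangle: for small [eps] the maximum is not attained
   on the sides, and the level sets are circles. *)
Lemma touching_disc A a b c q t : open A -> seg_in A b a -> seg_in A b c ->
  ~ A q -> 0 <= t <= 1 -> q = a + t *: (c - a) ->
  exists p z r, [/\ ~ A p, 0 < enorm (p - z), 0 < r &
    forall y, ~ A y -> enorm (y - p) < r -> enorm (y - z) <= enorm (p - z)].
Proof.
move=> oA ba bc nq t01 qE.
pose D := cross (a - b) (c - b).
have D0 : D != 0.
  by apply/eqP => D0; apply: nq; apply: collinear_seg ba bc t01 qE D0.
have [d1 d10 Ha] := seg_extend oA ba; have [d2 d20 Hc] := seg_extend oA bc.
pose d := Num.min d1 d2.
have d0 : 0 < d by rewrite lt_min d10.
have {}Ha s : 0 <= s <= 1 + d -> A (b + s *: (a - b)).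
  move=> /andP[s0 s1]; apply: Ha; rewrite s0 (le_trans s1)//.
  by rewrite lerD2l ge_min lexx.
have {}Hc s : 0 <= s <= 1 + d -> A (b + s *: (c - b)).
  move=> /andP[s0 s1]; apply: Hc; rewrite s0 (le_trans s1)//.
  by rewrite lerD2l ge_min lexx orbT.
(* [ga] and [gc] form the basis dual to [a - b] and [c - b]: they are the gradients of the
   barycentric coordinates [al] and [be]. *)
pose ga : V := D^-1 *: rot (c - b).
pose gc : V := - D^-1 *: rot (a - b).
pose g := ga + gc.
pose al y := dot (y - b) ga; pose be y := dot (y - b) gc.
have dgE y : dot (y - b) g = al y + be y by rewrite /al /be !dotE !mxE; ring.
have yE y : y = b + al y *: (a - b) + be y *: (c - b).
  have dotZr z w (k : R) : dot z (k *: w) = k * dot z w by rewrite !dotE !mxE; ring.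
  rewrite /al /be /ga /gc !dotZr !dot_rot.
  have Dn : (a 0 0 - b 0 0) * (c 0 1 - b 0 1) - (a 0 1 - b 0 1) * (c 0 0 - b 0 0) != 0.
    by move: D0; rewrite /D /cross !mxE.
  by apply/rowP => -[[|[|//]]] h; [have -> : Ordinal h = 0 by exact: val_inj
    |have -> : Ordinal h = 1 by exact: val_inj];
    rewrite !mxE /D /cross !mxE; field.
have [alq beq] : al q = 1 - t /\ be q = t.
  have Dn : (a 0 0 - b 0 0) * (c 0 1 - b 0 1) - (a 0 1 - b 0 1) * (c 0 0 - b 0 0) != 0.
    by move: D0; rewrite /D /cross !mxE.
  by rewrite qE /al /be /ga /gc !dotE !mxE /= /D /cross !mxE; split; field.
have gg0 : 0 < dot g g.
  rewrite lt_neqAle dot_ge0 andbT eq_sym; apply/eqP => /dot_eq0 g0.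
  have := dgE q; rewrite g0 alq beq subrK (_ : dot _ 0 = 0).
    by move/eqP; rewrite eq_sym oner_eq0.
  by rewrite dotE !mxE; ring.
move: yE dgE alq beq; clearbody ga gc => yE dgE alq beq.
(* [L] bounds [|y - b|] on the enlarged triangle. The first bound on [eps] keeps the maximum off the
   side opposite [b]; the second places the centre [z] below beyond that side. *)
pose L := (1 + d) * (enorm (a - b) + enorm (c - b)).
pose eps := Num.min (d / (2 * (L ^+ 2 + 1))) (dot g g / (4 * (1 + d))).
have L1 : 0 < L ^+ 2 + 1 by rewrite ltr_wpDl ?sqr_ge0.
have d1' : 0 < 1 + d by rewrite addr_gt0.
have eps0 : 0 < eps by rewrite lt_min !divr_gt0// ?mulr_gt0.
have epsL : eps * L ^+ 2 < d.
  have : eps * (2 * (L ^+ 2 + 1)) <= d.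
    by rewrite -ler_pdivlMr ?mulr_gt0// ge_min lexx.
  have := mulr_ge0 (ltW eps0) (sqr_ge0 L).
  by rewrite mulrCA mulrDr mulr1; lra.
have epsg : 2 * eps * (1 + d) < dot g g.
  have : eps * (4 * (1 + d)) <= dot g g.
    by rewrite -ler_pdivlMr ?mulr_gt0// ge_min lexx orbT.
  have := mulr_gt0 eps0 d1'.
  by rewrite mulrCA -mulrA; lra.
pose K := ~` A `&` ([set y | dot b ga <= dot y ga] `&`
  ([set y | dot b gc <= dot y gc] `&`
   [set y | dot b (- g) - (1 + d) <= dot y (- g)])).
have KP y : K y <-> [/\ ~ A y, 0 <= al y, 0 <= be y & al y + be y <= 1 + d].
  have e1 : al y = dot y ga - dot b ga by rewrite /al !dotE !mxE; ring.
  have e2 : be y = dot y gc - dot b gc by rewrite /be !dotE !mxE; ring.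
  have e3 : al y + be y = dot b (- g) - dot y (- g).
    by rewrite -dgE !dotE !mxE; ring.
  rewrite e3 e1 e2 !subr_ge0 lerBlDr addrC -lerBlDr.
  by split=> [[? [? [? ?]]]|[? ? ? ?]]; split.
have KL y : K y -> enorm (y - b) <= L.
  move=> /KP[_ a0 b0 ab]; rewrite {1}(yE y).
  rewrite addrAC [b + _ - b]addrAC subrr add0r.
  rewrite (le_trans (ler_enormD _ _))// !enormZ !ger0_norm//.
  rewrite /L mulrDr lerD// ler_wpM2r ?enorm_ge0//; lra.
have cK : compact K.
  apply: (compact_enorm (c := b) (r := L)) => //.
  apply: closedI; first exact: open_closedC.
  by apply: closedI; [|apply: closedI]; exact: closed_dot_ge.
pose F y := eps * (enorm (y - b) * enorm (y - b)) + (-1) * (dot y g + - dot b g).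
have FE y : F y = eps * dot (y - b) (y - b) - (al y + be y).
  rewrite /F -expr2 sqr_enorm mulN1r -dgE; congr (_ - _).
  by rewrite !dotE !mxE; ring.
have cF : continuous F.
  apply: continuous_funD.
    apply: continuous_funM; first exact: continuous_cst.
    by apply: continuous_funM; exact: continuous_enormB.
  apply: continuous_funM; first exact: continuous_cst.
  by apply: continuous_funD; [exact: continuous_dot|exact: continuous_cst].
have Kq : K q.
  by apply/KP; rewrite alq beq subrK subr_ge0 lerDl (ltW d0); case/andP: t01.
have [p /set_mem Kp pmax] := compact_EVT_max (ex_intro _ q Kq) cK (continuous_subspaceT cF).
have {}pmax y : K y -> F y <= F p by move=> Ky; apply: pmax; exact: mem_set.
have [nAp ap bp abp] := (KP p).1 Kp.
(* [F q >= -1], whereas [al p + be p >= 1 + d] would give [F p <= eps * L ^+ 2 - 1 - d < -1]. *)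
have abp' : al p + be p < 1 + d.
  have := pmax _ Kq; rewrite !FE alq beq subrK.
  have := mulr_ge0 (ltW eps0) (dot_ge0 (q - b)).
  have : eps * dot (p - b) (p - b) <= eps * L ^+ 2.
    rewrite ler_pM2l// -sqr_enorm ler_sqr ?nnegrE ?enorm_ge0// ?KL//.
    by rewrite (le_trans _ (KL _ Kp))// enorm_ge0.
  by move: epsL; lra.
(* With [al p = 0] the point lies on the prolonged segment from [b] through [c], which is contained
   in [A]; likewise for [be p]. *)
have ap' : 0 < al p.
  rewrite lt_neqAle ap andbT; apply/eqP => ap0; apply: nAp.
  by rewrite (yE p) -ap0 scale0r addr0; apply: Hc; rewrite bp -[leLHS]add0r ap0.
have bp' : 0 < be p.
  rewrite lt_neqAle bp andbT; apply/eqP => bp0; apply: nAp.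
  by rewrite (yE p) -bp0 scale0r addr0; apply: Ha; rewrite ap -[leLHS]addr0 bp0.
have : nbhs p [set y | [/\ 0 < al y, 0 < be y & al y + be y < 1 + d]].
  have n1 : nbhs p [set y | dot b ga < dot y ga].
    by apply: nbhs_dot_gt; move: ap'; rewrite /al !dotE !mxE; lra.
  have n2 : nbhs p [set y | dot b gc < dot y gc].
    by apply: nbhs_dot_gt; move: bp'; rewrite /be !dotE !mxE; lra.
  have n3 : nbhs p [set y | dot b (- g) - (1 + d) < dot y (- g)].
    by apply: nbhs_dot_gt; move: abp'; rewrite -dgE !dotE !mxE; lra.
  apply: (@filterS _ (nbhs p) _ _ _ _ (filterI n1 (filterI n2 n3))) => y /= [h1 [h2 h3]].
  split; first by move: h1; rewrite /al !dotE !mxE; lra.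
    by move: h2; rewrite /be !dotE !mxE; lra.
  by move: h3; rewrite -dgE !dotE !mxE; lra.
move=> /nbhs_enormP[r r0 Hr].
(* Completing the square: up to a constant, [F] is [eps] times the squared distance to [z]. *)
pose z := b + (2 * eps)^-1 *: g.
have zE y : eps * dot (y - z) (y - z) = F y + dot g g / (4 * eps).
  rewrite FE -dgE /z !dotE !mxE; move: (lt0r_neq0 eps0) => eps_n0; clearbody eps.
  by field.
exists p, z, r; split => //.
  apply: enorm_gt0; rewrite subr_eq0; apply/eqP => pz.
  move: abp'; rewrite -dgE {1}pz /z [b + _]addrC addrK.
  rewrite (_ : dot _ g = dot g g / (2 * eps)); last by rewrite !dotE !mxE; ring.
  by rewrite ltr_pdivrMr ?mulr_gt0// mulrC ltNge => /negP; apply; exact: ltW.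
move=> y nAy yp; have [h1 h2 h3] := Hr y yp.
have Ky : K y by apply/KP; split => //; exact: ltW.
rewrite -ler_sqr ?nnegrE ?enorm_ge0// !sqr_enorm -(ler_pM2l eps0) !zE lerD2r.
exact: pmax.
Qed.
End touching_disc.

(** * From the gradient bound to convexity *)

Section gradient_bound_convex.
Context {R : realType}.
Notation V := 'rV[R]_2.
Implicit Types (x y z p : V) (A : set V) (v : V -> R) (mu r s t : R).

(** By the gradient bound and Cauchy-Schwarz, [v (x + t w) * exp (- mu t |w|)] is nonincreasing in
    [t]. At [t = 1] the value of [v] is [1], since [p] is a limit of points of [A] outside [A]. *)
Lemma gradient_bound_ge A mu v x p : open A -> 0 < mu ->
  classical_solution A mu v ->
  (forall y, A y -> enorm (gradient v y) <= mu * v y) ->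
  (forall t, 0 <= t < 1 -> A (x + t *: (p - x))) -> ~ A p ->
  expR (- (mu * enorm (p - x))) <= v x.
Proof.
move=> oA mu0 [[v2 _] vc _ v1] Hg Hseg nAp.
set w := p - x; pose k := - (mu * enorm w).
have pE : x + 1 *: w = p by rewrite scale1r addrC subrK.
have shift s t : x + s *: w - (x + t *: w) = (s - t) *: w.
  by rewrite opprD addrACA subrr add0r -scalerBl.
have cp : closure A p.
  apply/closure_enormP => e e0.
  have n0 : 0 < enorm w + 1 by rewrite ltr_wpDl ?enorm_ge0.
  pose d := Num.min 1 (e / (enorm w + 1)).
  have d0 : 0 < d by rewrite lt_min ltr01 divr_gt0.
  have d1 : d <= 1 by rewrite ge_min lexx.
  have de : d * (enorm w + 1) <= e by rewrite -ler_pdivlMr// ge_min lexx orbT.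
  exists (x + (1 - d) *: w).
    by apply: Hseg; rewrite subr_ge0 d1 ltrBlDr ltrDl.
  rewrite -{1}pE shift enormZ addrAC subrr add0r normrN gtr0_norm//.
  by apply: lt_le_trans de; rewrite ltr_pM2l// ltrDl.
have ccl t : 0 <= t <= 1 -> closure A (x + t *: w).
  move=> /andP[t0]; rewrite le_eqVlt => /orP[/eqP ->|t1]; first by rewrite pE.
  by apply: subset_closure; apply: Hseg; rewrite t0.
pose f t := v (x + t *: w) * expR (0 + t * k).
have de t : is_derive t 1 (fun s => expR (0 + s * k)) (expR (0 + t * k) * k).
  exact: is_derive1_comp (is_derive_expR _) (is_derive_affine 0 k t).
have df t : 0 <= t < 1 -> is_derive t 1 f
    (v (x + t *: w) * (expR (0 + t * k) * k) + expR (0 + t * k) * dot (gradient v (x + t *: w)) w).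
  move=> t01; have At := Hseg t t01.
  have h := is_deriveM (line_is_derive (C1_is_derive w oA v2 At)) (de t).
  exact: h.
have f10 : f 1 <= f 0.
  apply: (@ler0_derive1_nincr R f 0 1) => //.
  - by move=> t; rewrite in_itv/= => /andP[t0 t1]; have [|] := df t; rewrite ?(ltW t0).
  - move=> t; rewrite in_itv/= => /andP[t0 t1].
    have t01 : 0 <= t < 1 by rewrite (ltW t0).
    have [_ dv] := df _ t01; rewrite derive1E dv.
    set E := expR _; have E0 : 0 < E by exact: expR_gt0.
    rewrite mulrCA -mulrDr pmulr_rle0// /k mulrN addrC subr_le0.
    rewrite (le_trans (dot_le _ _))// mulrCA mulrA ler_wpM2r ?enorm_ge0//.
    exact/Hg/Hseg.
  (* The end point [t = 1] corresponds to [p], where only the continuity of [v] on the closure is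
     available. *)
  - apply/(subspace_continuousP _ f) => t; rewrite /= in_itv/= => t01.
    have ct : {for t, continuous (fun s => expR (0 + s * k))}.
      by apply/differentiable_continuous/derivable1_diffP; case: (de t).
    apply: cvgM; last exact: cvg_within_filter ct.
    apply/cvgrPdist_lt => e e0.
    rewrite near_withinE.
    have [d d0 Hd] := (within_enormP _ _).1 vc _ (ccl t t01) e e0.
    have n0 : 0 < enorm w + 1 by rewrite ltr_wpDl ?enorm_ge0.
    apply/nbhs_normP; exists (d / (enorm w + 1)) => /=; first by rewrite divr_gt0.
    move=> s /=; rewrite /ball_ /= ltr_pdivlMr// => ts; rewrite in_itv/= => s01.
    rewrite distrC; apply: Hd; first exact: ccl.
    rewrite shift enormZ distrC (le_lt_trans _ ts)// ler_wpM2l//.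
    by rewrite lerDl.
move: f10; rewrite /f pE mul0r !add0r mul1r expR0 mulr1 scale0r addr0 v1 ?mul1r//.
by split => //; rewrite /interior => /nbhs_singleton.
Qed.

(** Superharmonicity of [- ln v / mu], tested by [psi] at a maximum of [v * exp (mu psi)]: [y] is
    the value of [v], [E] that of the exponential, [g], [h] and [P], [Q] are the derivatives of [v]
    and [psi]. The first-order conditions and the gradient bound give [|P| <= 1]; the second-order
    ones sum to [mu * (1 - |P|^2) + Q0 + Q1 <= 0]. *)
Lemma touching_bound (E y mu g0 g1 h0 h1 P0 P1 Q0 Q1 : R) :
  0 < E -> 0 < y -> 0 < mu ->
  g0 * E + y * (E * (mu * P0)) = 0 -> g1 * E + y * (E * (mu * P1)) = 0 ->
  h0 * E + 2 * (g0 * (E * (mu * P0))) + y * (E * ((mu * P0) ^+ 2 + mu * Q0)) <= 0 ->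
  h1 * E + 2 * (g1 * (E * (mu * P1))) + y * (E * ((mu * P1) ^+ 2 + mu * Q1)) <= 0 ->
  h0 + h1 = mu ^+ 2 * y -> g0 ^+ 2 + g1 ^+ 2 <= (mu * y) ^+ 2 -> Q0 + Q1 <= 0.
Proof.
move=> E0 y0 mu0 e0 e1 l0 l1 hh gg.
have g0E : g0 = - (y * (mu * P0)).
  by apply: (mulIf (lt0r_neq0 E0)); apply/eqP; rewrite -subr_eq0; apply/eqP; rewrite -e0; ring.
have g1E : g1 = - (y * (mu * P1)).
  by apply: (mulIf (lt0r_neq0 E0)); apply/eqP; rewrite -subr_eq0; apply/eqP; rewrite -e1; ring.
have P1' : P0 ^+ 2 + P1 ^+ 2 <= 1.
  rewrite -(ler_pM2l (exprn_gt0 2 (mulr_gt0 mu0 y0))) mulr1.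
  by apply: le_trans gg; rewrite le_eqVlt; apply/orP; left; apply/eqP; rewrite g0E g1E; ring.
have : E * (y * mu * (mu * (1 - (P0 ^+ 2 + P1 ^+ 2)) + (Q0 + Q1))) <= 0.
  apply: le_trans (_ : _ <= 0 + 0) _; last by rewrite addr0.
  apply: le_trans (lerD l0 l1); rewrite le_eqVlt; apply/orP; left; apply/eqP.
  have -> : h0 = mu ^+ 2 * y - h1 by rewrite -hh addrK.
  by rewrite g0E g1E; ring.
rewrite pmulr_rle0// pmulr_rle0 ?mulr_gt0// => h.
have : 0 <= mu * (1 - (P0 ^+ 2 + P1 ^+ 2)) by rewrite mulr_ge0 ?subr_ge0// ltW.
lra.
Qed.

(* Near the contact point the distance to the complement of [A] is at least
   [|x - z| - |p - z|], with equality on the normal. For [psi] this function minus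
   a small paraboloid, up to a constant, some multiple of [exp (- mu psi)] touches
   [v mu] from above. The choice of [eta] keeps the Laplacian of [psi] positive;
   those of [s] and [mu] make the error of the barrier smaller than the paraboloid
   on the boundary of the ball. *)
Lemma touching_disc_contradiction A (v : R -> V -> R) mu0 p z r :
  open A -> bounded_set A ->
  (forall mu, 0 < mu -> classical_solution A mu (v mu)) -> 0 < mu0 ->
  (forall mu, mu0 <= mu -> forall x, A x -> enorm (gradient (v mu) x) <= mu * v mu x) ->
  ~ A p -> 0 < enorm (p - z) -> 0 < r ->
  ~ (forall y, ~ A y -> enorm (y - p) < r -> enorm (y - z) <= enorm (p - z)).
Proof.
move=> oA bA sv mu00 Hg nAp rho0 r0 disc.
set rho := enorm (p - z) in rho0 disc.
pose n := rho^-1 *: (p - z).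
have n1 : enorm n = 1 by rewrite enormZ gtr0_norm ?invr_gt0// mulVf// gt_eqF.
have pz : p - z = rho *: n by rewrite scalerA mulfV ?gt_eqF// scale1r.
pose t := r / 4; have t0 : 0 < t by rewrite divr_gt0.
pose x0 := p + t *: n.
(* Beyond [p] on the ray from [z] the distance to [z] exceeds [rho], so [disc] excludes complement
   points. *)
have lineA s : 0 < s <= t -> A (p + s *: n).
  move=> /andP[s0 st]; apply: contrapT => /disc.
  rewrite [p + _ - p]addrC addKr enormZ n1 mulr1 gtr0_norm//.
  have -> : p + s *: n - z = (rho + s) *: n by rewrite addrAC pz scalerDl.
  rewrite enormZ n1 mulr1 gtr0_norm ?addr_gt0//.
  have sr : s < r by rewrite (le_lt_trans st)// /t; lra.
  by move=> /(_ sr); rewrite gerDl leNgt s0.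
have x0p : enorm (x0 - p) = t by rewrite /x0 addrC addKr enormZ n1 mulr1 gtr0_norm.
have x0z : enorm (x0 - z) = rho + t.
  by rewrite /x0 addrAC pz -scalerDl enormZ n1 mulr1 gtr0_norm ?addr_gt0.
pose sg := t / 2; have sg0 : 0 < sg by rewrite divr_gt0.
(* If [y] is within [r] of [p], use [disc]. Otherwise [|y - x| >= r - t - sg = 5 r / 8], while
   [|x - z| - rho <= t + sg = 3 r / 8]. *)
have hd x : enorm (x - x0) <= sg -> forall y, ~ A y -> enorm (x - z) - rho <= enorm (y - x).
  move=> xs y nAy; have [yp|yp] := ltP (enorm (y - p)) r.
    have := disc y nAy yp; have := ler_enormB x y z; rewrite (enormBC x y); lra.
  have := ler_enormB x x0 z; have := ler_enormB y x p; have := ler_enormB x x0 p.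
  by rewrite x0p x0z; move: xs yp; rewrite /sg /t; lra.
have hx x : enorm (x - x0) <= sg -> rho + sg <= enorm (x - z) <= rho + t + sg.
  move=> xs; have := ler_enormB x0 x z; have := ler_enormB x x0 z.
  rewrite x0z (enormBC x0 x) => h1 h2.
  by apply/andP; split; move: xs h1 h2; rewrite /sg; lra.
have hA x : enorm (x - x0) <= sg -> A x.
  move=> xs; apply: contrapT => nAx; have := hd x xs x nAx.
  rewrite subrr enorm0.
  by have /andP[+ _] := hx x xs; move: sg0; lra.
(* On the disc [|x - z| < 2 * (rho + t)], so the Laplacian [1 / |x - z|] of the distance to [z]
   exceeds [4 * eta], that of the paraboloid. *)
pose eta := (8 * (rho + t))^-1.
have M0 : 0 < rho + t by rewrite addr_gt0.
have eta0 : 0 < eta by rewrite invr_gt0 mulr_gt0.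
pose s := eta * sg ^+ 2 / 2.
have s0 : 0 < s by rewrite divr_gt0// mulr_gt0// exprn_gt0.
(* The summands ensure [mu >= mu0], then [mu * s > 1] for the barrier, then [2 * t / s < mu * s]. By
   the choice of [s], the paraboloid equals [2 * s] at distance [sg] from [x0]. *)
pose mu := mu0 + s^-1 + (2 * t) / s ^+ 2.
have mu_gt0 : 0 < mu by rewrite !addr_gt0 ?invr_gt0// divr_gt0 ?mulr_gt0// exprn_gt0.
have mu_ge : mu0 <= mu.
  rewrite /mu -addrA lerDl addr_ge0 ?invr_ge0 ?divr_ge0 ?mulr_ge0 ?exprn_ge0//;
  exact: ltW.
have mus : 1 < mu * s /\ 2 * t < mu * s * s.
  have sn := lt0r_neq0 s0.
  have -> : mu * s * s = mu0 * s * s + s + 2 * t by rewrite /mu; field.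
  have -> : mu * s = mu0 * s + 1 + 2 * t / s by rewrite /mu; field.
  have h1 := mulr_gt0 mu00 s0; have h2 := mulr_gt0 h1 s0.
  have h3 : 0 < 2 * t / s by rewrite divr_gt0 ?mulr_gt0.
  by split; lra.
have {}Hg := Hg mu mu_ge; have {}sv := sv mu mu_gt0.
have ub x : enorm (x - x0) <= sg ->
    v mu x <= expR (- (mu - s^-1) * (enorm (x - z) - rho - s)).
  move=> xs; apply: (solution_le_ball oA bA mu_gt0 sv (hA x xs) s0 (ltW mus.1)).
  exact: hd.
have lb : expR (- (mu * t)) <= v mu x0.
  have := gradient_bound_ge (x := x0) (p := p) oA mu_gt0 sv Hg.
  rewrite enormBC x0p; apply => // a /andP[a0 a1].
  have -> : x0 + a *: (p - x0) = p + (t * (1 - a)) *: n.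
    by apply/rowP => i; rewrite !mxE; ring.
  apply: lineA; rewrite mulr_gt0 ?subr_gt0//= -[leRHS]mulr1 ler_pM2l//.
  by rewrite gerBl.
pose B := [set x | enorm (x - x0) <= sg].
have cB : compact B.
  by apply: (compact_enorm (c := x0) (r := sg)) => //; exact: closed_enorm_ball.
have [[v1 v2] vc vE _] := sv.
pose N x := Num.sqrt (dot (x - z) (x - z)).
pose psi x := N x + (- eta) * dot (x - x0) (x - x0).
pose G x := v mu x * expR (mu * psi x).
have cG : {within B, continuous G}.
  apply: (continuous_funM (T := subspace B)).
    apply: (continuous_subspaceW (B := closure A)) vc => x /hA Ax.
    exact: subset_closure.
  apply: continuous_subspaceT; apply: continuous_post; first exact: continuous_expR.
  apply: continuous_funM; first exact: continuous_cst.
  apply: continuous_funD.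
    rewrite (_ : N = (fun x => enorm (x - z))); first exact: continuous_enormB.
    by apply/funext => x; rewrite enormE.
  apply: continuous_funM; first exact: continuous_cst.
  rewrite (_ : (fun x => _) = (fun x => enorm (x - x0) * enorm (x - x0))).
    by apply: continuous_funM; exact: continuous_enormB.
  by apply/funext => x; rewrite -expr2 sqr_enorm.
have Bx0 : B x0 by rewrite /B /= subrr enorm0 ltW.
have [x1 /set_mem Bx1 Gmax] := compact_EVT_max (ex_intro _ x0 Bx0) cB cG.
have {}Gmax x : B x -> G x <= G x1 by move=> Bx; apply: Gmax; exact: mem_set.
have G0 : expR (mu * rho) <= G x0.
  rewrite /G (_ : psi x0 = rho + t).
    rewrite (@le_trans _ _ (expR (- (mu * t)) * expR (mu * (rho + t))))//.
      by rewrite -expRD ler_expR mulrDr addrCA addNr addr0.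
    by rewrite ler_pM2r// expR_gt0.
  by rewrite /psi /N -enormE x0z -sqr_enorm subrr enorm0 expr0n mulr0 addr0.
have G1 := le_trans G0 (Gmax _ Bx0).
have v1_gt0 : 0 < v mu x1.
  by rewrite -(pmulr_lgt0 _ (expR_gt0 (mu * psi x1))) (lt_le_trans _ G1)// expR_gt0.
(* At distance [sg], [G1] and [ub] would give [mu * s + 1 <= (|x1 - z| - rho) / s], whose right side
   is at most [2 * t / s < mu * s]. *)
have lt_sg : enorm (x1 - x0) < sg.
  rewrite lt_neqAle Bx1 andbT; apply/eqP => x1s.
  have : expR (mu * rho) <= expR (- (mu - s^-1) * (enorm (x1 - z) - rho - s)) * expR (mu * psi x1).
    by apply: (le_trans G1); rewrite ler_pM2r ?expR_gt0//; exact: ub.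
  rewrite -expRD ler_expR /psi /N -enormE -sqr_enorm x1s.
  have -> : - eta * sg ^+ 2 = - (2 * s) by rewrite /s; field.
  have /andP[_] := hx x1 Bx1; set ph := enorm (x1 - z) => hph.
  have := mus; have : 0 < s^-1 by rewrite invr_gt0.
  have : s^-1 * s = 1 by rewrite mulVf// gt_eqF.
  have hph2 : ph - rho <= 2 * t by move: hph; rewrite /sg; move: t0; lra.
  set si := s^-1 => sis si0 [m1 m2] hh.
  have k1 : si * (ph - rho) <= si * (2 * t) by rewrite ler_pM2l.
  have k2 : si * (2 * t) < mu * s.
    by rewrite -(ltr_pM2l s0) mulrA [s * si]mulrC sis mul1r [ltRHS]mulrC.
  by move: hh k1 k2 sis; clear; lra.
have nB : nbhs x1 B.
  apply/nbhs_enormP; exists (sg - enorm (x1 - x0)); first by rewrite subr_gt0.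
  by move=> y yx1; rewrite /B/=; have := ler_enormB y x1 x0; lra.
have maxG : \forall y \near x1, G y <= G x1.
  by apply: filterS nB => y; exact: Gmax.
have Ax1 := hA _ Bx1.
have n_gt0 : 0 < enorm (x1 - z).
  by have /andP[+ _] := hx _ Bx1; apply: lt_le_trans; rewrite addr_gt0.
have rad0 : 0 < dot (x1 - z) (x1 - z) by rewrite -sqr_enorm exprn_gt0.
have JN := jets_sqrt (f := fun y => dot (y - z) (y - z)) rad0 (jets_sqr z x1).
have Jpsi := jetsD JN (jetsZ (- eta) (jets_sqr x0 x1)).
have J := jetsM (C2_jets oA (conj v1 v2) Ax1) (jets_expR (jetsZ mu Jpsi)).
have J0 i := jets_max maxG J i.
have lap := vE _ Ax1; rewrite laplacianE in lap; move/subr0_eq: lap => lap.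
have grad : dot (gradient (v mu) x1) (gradient (v mu) x1) <= (mu * v mu x1) ^+ 2.
  rewrite -sqr_enorm ler_sqr ?nnegrE ?enorm_ge0//; first exact: Hg.
  by rewrite mulr_ge0// ltW.
rewrite dotE !mxE -!expr2 in grad.
have := touching_bound (expR_gt0 (mu * psi x1)) v1_gt0 mu_gt0
  (J0 0).1 (J0 1).1 (J0 0).2 (J0 1).2 lap grad.
rewrite -!enormE.
have := sqr_enorm (x1 - z); rewrite dotE.
have /andP[_] := hx _ Bx1.
move: n_gt0; move: (enorm (x1 - z)) ((x1 - z) 0 0) ((x1 - z) 0 1) => m e0 e1.
move=> m0 m_le m2; have mn0 := lt0r_neq0 m0.
(* The Laplacian of [psi] at [x1] is [m^-1 - 4 * eta] with [m = |x1 - z|], positive by the choice of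
   [eta]. *)
rewrite [leLHS](_ : _ = 2 / m - (e0 * e0 + e1 * e1) / m ^+ 3 - 4 * eta); last by field.
rewrite -m2 [leLHS](_ : _ = m^-1 - 4 * eta); last by field.
rewrite subr_le0 (_ : 4 * eta = (2 * (rho + t))^-1); last first.
  by rewrite /eta; field; exact: lt0r_neq0.
rewrite lef_pV2 ?posrE ?mulr_gt0// leNgt => /negP; apply.
by apply: le_lt_trans m_le _; rewrite /sg; move: t0 rho0; clear; lra.
Qed.

End gradient_bound_convex.

(** * The equivalence, and the bound for every [mu] on convex domains *)

Theorem theorem1 (R : realType) (Omega : set 'rV[R]_2)
    (v : R -> 'rV[R]_2 -> R)
    (hOmega : bounded_lipschitz_domain Omega)
    (hv : forall mu : R, 0 < mu -> classical_solution Omega mu (v mu)) :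
  ((exists mu0 : R, 0 < mu0 /\
      forall mu : R, mu0 <= mu ->
      forall x : 'rV[R]_2, Omega x ->
        enorm (gradient (v mu) x) <= mu * v mu x)
   <-> convex_set Omega)
  /\
  (convex_set Omega ->
     forall mu : R, 0 < mu ->
     forall x : 'rV[R]_2, Omega x ->
       enorm (gradient (v mu) x) <= mu * v mu x).
Proof.
have [dOm bOm _] := hOmega; have [_ oOm cOm] := dOm.
have cvx : convex_set Omega -> forall mu : R, 0 < mu ->
    forall x : 'rV[R]_2, Omega x -> enorm (gradient (v mu) x) <= mu * v mu x.
  by move=> cv mu mu0 x; exact: convex_gradient_le (hv mu mu0) cv.
split; last exact: cvx.
split=> [[mu0 [mu00 Hg]]|cv]; last first.
  by exists 1; split => // mu mu1; apply: cvx => //; exact: lt_le_trans mu1.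
apply: contrapT => ncv.
have [a [b [c [q [ba bc nq [t t01 qE]]]]]] := nonconvex_triangle oOm cOm ncv.
have [p [z [r [np pz r0 disc]]]] := touching_disc oOm ba bc nq t01 qE.
exact: (touching_disc_contradiction oOm bOm hv mu00 Hg np pz r0 disc).
Qed.
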